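(* Let $n\ge 2$ be an integer and let $C\subset\mathbb P^2$ be a smooth plane curve of degree $2n+1$. Let $X:=v_{n-1}(C)\subset\mathbb P^N$, $N=\binom{n+1}{2}-1$, where $v_{n-1}$ is the $(n-1)$-tuple Veronese embedding of $\mathbb P^2$ (so that $X$ is a projectively normal half-canonical curve), and let $A=S_X/\langle\eta_1,\eta_2\rangle$ be the corresponding Artinian graded Gorenstein ring, with $\eta_1,\eta_2$ two general linear forms on $\mathbb P^N$. Then the Macaulay polynomial of $A$ is a quartic of Waring number at most $(n-1)^2$.
   Context: We work over $\mathbb C$. $S_X$ denotes the homogeneous coordinate ring of $X\subset\mathbb P^N$. Half-canonical means $\omega_X\cong\mathcal O_X(2)$. For general $\eta_1,\eta_2$ the ring $A$ is Artinian graded Gorenstein with socle of dimension one; it is a quotient of $T=\mathbb C[\mathbb P^N]/\langle\eta_1,\eta_2\rangle\cong\mathbb C[\partial_0,\dots,\partial_{N-2}]$. Let $T$ act on $\mathbb C[x_0,\dots,x_{N-2}]$ by $\partial_i=\partial/\partial x_i$. By Macaulay's theorem there is a homogeneous form $F\in\mathbb C[x_0,\dots,x_{N-2}]$, unique up to nonzero scalar, whose degree is the socle degree of $A$, with $A=T/F^\perp$, $F^\perp=\{D\in T: D\cdot F=0\}$; $F$ is called the Macaulay polynomial of $A$. The Waring number of a form $F$ of degree $d$ is the minimal $r$ such that $F=\lambda_1\ell_1^d+\dots+\lambda_r\ell_r^d$ with $\lambda_i\in\mathbb C^*$ and $\ell_i$ linear forms. *)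

(* Defs.v *)
From mathcomp Require Import all_boot all_order all_algebra.
From mathcomp Require Import mpoly.

Set Implicit Arguments.
Unset Strict Implicit.
Unset Printing Implicit Defensive.

Import GRing.Theory.
Local Open Scope ring_scope.

Section Generalities.
Variable K : fieldType.

(* Sets of polynomials, in particular ideals, are Prop-valued predicates; the
   quotient of a polynomial ring by an ideal is represented by that ideal. *)
Definition ideal_gen (k : nat) (S : {mpoly K[k]} -> Prop) (P : {mpoly K[k]}) :
    Prop :=
  exists (r : nat) (a g : 'I_r -> {mpoly K[k]}),
    (forall i, S (g i)) /\ P = \sum_(i < r) a i * g i.

(* Points of projective space P^(k-1) are given by their representatives,
   i.e. nonzero vectors. *)
Definition nonzero_vec (k : nat) (v : 'I_k -> K) : Prop := exists i, v i != 0.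

(* [X] is a set of points of P^(k-1), given as the set of all their
   representatives. *)
Definition homog_ideal (k : nat) (X : ('I_k -> K) -> Prop) :
    {mpoly K[k]} -> Prop :=
  ideal_gen (fun P => (exists d, P \is d.-homog) /\
                      forall w, X w -> P.@[w] = 0).

Definition zariski_open (k : nat) (U : ('I_k -> K) -> Prop) : Prop :=
  exists S : {mpoly K[k]} -> Prop,
    forall x, U x <-> exists2 g, S g & g.@[x] != 0.

Definition for_general (k : nat) (Q : ('I_k -> K) -> Prop) : Prop :=
  exists U : ('I_k -> K) -> Prop,
    [/\ zariski_open U, exists x, U x & forall x, U x -> Q x].

Definition linear_form (k : nat) (a : 'I_k -> K) : {mpoly K[k]} :=
  \sum_(i < k) a i *: 'X_i.

(* A pair of linear forms is a point of the affine space K^(k+k). *)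
Definition for_general_linear_forms2 (k : nat)
    (Q : {mpoly K[k]} -> {mpoly K[k]} -> Prop) : Prop :=
  for_general (fun u : 'I_(k + k) -> K =>
    Q (linear_form (u \o @lshift k k)) (linear_form (u \o @rshift k k))).

End Generalities.

Section MacaulayPolynomials.
Variables (K : fieldType) (k : nat).
Implicit Types (J : {mpoly K[k]} -> Prop) (D F : {mpoly K[k]}).

(* The action of the variables of [D] by partial derivatives on [F]. *)
Definition diff_act D F : {mpoly K[k]} :=
  \sum_(m <- msupp D) D@_m *: F^`M[m].

Definition in_socle J D : Prop := forall i : 'I_k, J ('X_i * D).

(* The quotient by the homogeneous ideal [J] is Artinian Gorenstein with socle
   concentrated in degree [d]: it vanishes in large degrees, and its socle is
   spanned by the nonzero class of a form of degree [d]. *)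
Definition artinian_gorenstein J (d : nat) : Prop :=
  (exists e0, forall e D, (e0 <= e)%N -> D \is e.-homog -> J D) /\
  exists s : {mpoly K[k]},
    [/\ s \is d.-homog, in_socle J s, ~ J s &
        forall D, in_socle J D -> exists c : K, J (D - c *: s)].

Definition macaulay_polynomial J F : Prop :=
  exists d : nat,
    [/\ artinian_gorenstein J d, F != 0, F \is d.-homog &
        forall D, J D <-> diff_act D F = 0].

Definition waring_decomposition (d : nat) F (r : nat) : Prop :=
  exists (lambda : 'I_r -> K) (l : 'I_r -> {mpoly K[k]}),
    [/\ forall i, lambda i != 0, forall i, l i \is 1.-homog &
        F = \sum_(i < r) lambda i *: l i ^+ d].

Definition waring_number (d : nat) F (r : nat) : Prop :=
  waring_decomposition d F r /\
  forall s, waring_decomposition d F s -> (r <= s)%N.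

End MacaulayPolynomials.

Section LinearSections.
Variables (K : fieldType) (N : nat).
Implicit Types (X : ('I_N.+1 -> K) -> Prop).

(* Substituting the linear forms [L] for the variables induces an isomorphism
   of graded algebras from T = K[P^N]/<eta1, eta2> to the polynomial ring in
   the N-1 variables d_0, ..., d_(N-2). *)
Definition section_coordinates (eta1 eta2 : {mpoly K[N.+1]})
    (L : N.+1.-tuple {mpoly K[N.-1]}) : Prop :=
  [/\ forall i, tnth L i \is 1.-homog,
      forall D : {mpoly K[N.-1]}, exists P : {mpoly K[N.+1]}, P \mPo L = D &
      forall P : {mpoly K[N.+1]},
        P \mPo L = 0 <-> ideal_gen (fun Q => Q = eta1 \/ Q = eta2) P].

(* S_X / <eta1, eta2> as a quotient of K[P^N]. *)
Definition section_ideal X (eta1 eta2 : {mpoly K[N.+1]}) :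
    {mpoly K[N.+1]} -> Prop :=
  ideal_gen (fun Q => [\/ homog_ideal X Q, Q = eta1 | Q = eta2]).

(* S_X / <eta1, eta2> as a quotient of T, in the coordinates [L]. *)
Definition section_ideal_in X (eta1 eta2 : {mpoly K[N.+1]})
    (L : N.+1.-tuple {mpoly K[N.-1]})
    (D : {mpoly K[N.-1]}) : Prop :=
  exists2 P, section_ideal X eta1 eta2 P & P \mPo L = D.

End LinearSections.

Section PlaneCurves.
Variable K : fieldType.

Definition smooth_plane_curve (d : nat) (f : {mpoly K[3]}) : Prop :=
  f \is d.-homog /\
  forall v : 'I_3 -> K, nonzero_vec v -> f.@[v] = 0 ->
    exists i : 'I_3, (f^`M(i)).@[v] != 0.

(* The monomials of degree [d] in three variables, each occurring once. *)
Definition ternary_monomials (d : nat) : seq 'X_{1..3} :=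
  [seq s2m t | t : d.-tuple 'I_3 <- enum (basis 3 d)].

Definition veronese_dim (n : nat) : nat := 'C(n.+1, 2).-1.

Lemma size_ternary_monomials (n : nat) :
  (0 < n)%N -> size (ternary_monomials n.-1) = (veronese_dim n).+1.
Proof.
case: n => // n _; rewrite size_basis /veronese_dim prednK ?bin_gt0 //.
by rewrite -[in RHS](@bin_sub n.+2 2) // !subSS subn0 addn2.
Qed.

(* The map underlying the (n-1)-tuple Veronese embedding of P^2. *)
Definition veronese (n : nat) (v : 'I_3 -> K) : 'I_(veronese_dim n).+1 -> K :=
  fun j => ('X_[nth 0%MM (ternary_monomials n.-1) j] : {mpoly K[3]}).@[v].

(* All representatives of points of v_{n-1}(C), where C is the curve f = 0. *)
Definition veronese_curve (n : nat) (f : {mpoly K[3]})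
    (w : 'I_(veronese_dim n).+1 -> K) : Prop :=
  exists (v : 'I_3 -> K) (c : K),
    [/\ nonzero_vec v, f.@[v] = 0, c != 0 & forall j, w j = c * veronese v j].

End PlaneCurves.

Arguments veronese_curve {K} n f w.

(* Main.v *)
Require Import Defs.
From HB Require Import structures.
From Stdlib Require Import Classical.
From mathcomp Require Import all_boot all_order all_algebra all_field.
From mathcomp Require Import reals complex.
From mathcomp Require Import ssrcomplements mpoly ring zify.

(* Put m = n - 1. Linear forms on P^N restrict to ternary forms of degree m, so
   A is the m-th Veronese subring of C[x, y, z]/(f, g1, g2) with f the equation
   of C and g1, g2 general of degree m. The ring C[x, y, z]/(g1, g2) is free over
   C[z] on the monomials x^i y^j with i, j < m, and the coefficient of
   x^(m-1) y^(m-1) is a residue which induces a perfect duality on it. Modulo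
   z - 1 the form f is invertible, and the residue of h / f is, on forms h of
   degree 4m, the functional that defines the Macaulay polynomial: this gives the
   Gorenstein property with socle degree 4. Modulo z - 1 one also has a reduced
   algebra of dimension m^2, so that this functional is a combination of the
   evaluations at the m^2 points g1 = g2 = 0, and the Macaulay polynomial is the
   same combination of the fourth powers of the dual linear forms. Every
   condition on g1 and g2 is the nonvanishing of a determinant that is polynomial
   in their coefficients; it is met when g1 = 0 and g2 = 0 are the lines of a
   grid whose vertices avoid C. *)

Set Implicit Arguments.
Unset Strict Implicit.
Unset Printing Implicit Defensive.

Import Order.TTheory GRing.Theory Num.Theory.
Local Open Scope ring_scope.

(** * Polynomials *)

(** The constants fit together as follows. The residue vanishes on forms of degree below 2(m-1).
    Modulo (g1, g2) there is a form f' of degree 2(m-1) with f f' = z^(4m+1), because f has degree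
    2m+3. A multiple a f of degree 4m has a of degree 2m-3, just below 2(m-1); so the residue of f'
    h kills f exactly in the degree of the quartics on P^N, and conversely a form h orthogonal to
    its complementary degree has f' h divisible by z^(4m+1), which then cancels. The ideal of X is
    given by vanishing at points. To express it through f one needs that a form vanishing on C is a
    multiple of f, and this is drawn from smoothness by restricting to generic lines. Genericity
    must be a polynomial condition, whereas coordinates in the quotient involve an inverse matrix
    and a decomposition in all degrees. The adjugate replaces the inverse at the price of a
    determinant factor, and degrees below 2m turn out to control all the others, so that finitely
    many determinants suffice. *)

Lemma mpoly_ring_ind (R : comNzRingType) (n : nat) (P : {mpoly R[n]} -> Prop) :
  (forall c, P c%:MP) -> (forall i, P 'X_i) ->
  (forall p q, P p -> P q -> P (p + q)) ->
  (forall p q, P p -> P q -> P (p * q)) -> forall p, P p.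
Proof.
move=> PC PX PD PM p; rewrite [p]mpolyE.
elim/big_ind: _ => [||m _]; [by rewrite -(mpolyC0 n); apply: PC | exact: PD |].
rewrite -mul_mpolyC; apply: (PM) => /=; first exact: PC.
rewrite mpolyXE_id; elim/big_ind: _ => [||i _].
- by rewrite -(mpolyC1 n); apply: PC.
- exact: PM.
elim: (m i) => [|k IH]; first by rewrite expr0 -(mpolyC1 n); apply: PC.
by rewrite exprS; apply: (PM).
Qed.

Lemma base_digits_inj (B n : nat) (f g : 'I_n -> nat) :
  (forall i, f i < B)%N -> (forall i, g i < B)%N ->
  (\sum_(i < n) f i * B ^ i = \sum_(i < n) g i * B ^ i)%N -> f =1 g.
Proof.
elim: n f g => [|n IH] f g fB gB; first by move=> _ [].
rewrite !big_ord_recl /= !expn0 !muln1.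
have sh (h : 'I_n.+1 -> nat) : (\sum_(i < n) h (lift ord0 i) * B ^ bump 0 i =
   (\sum_(i < n) h (lift ord0 i) * B ^ i) * B)%N.
  by rewrite big_distrl /=; apply: eq_bigr => i _; rewrite /bump add1n expnSr mulnA.
rewrite !sh => e.
have e0 : f ord0 = g ord0.
  by have := congr1 (modn^~ B) e; rewrite ![(_ + _ * B)%N]addnC !modnMDl !modn_small.
have B0 : (0 < B)%N by apply: leq_ltn_trans (fB ord0).
move: e; rewrite e0 => /addnI/eqP; rewrite eqn_pmul2r // => /eqP e.
have h := IH _ _ (fun i => fB (lift ord0 i)) (fun i => gB (lift ord0 i)) e.
by move=> i; case: (unliftP ord0 i) => [j ->|->].
Qed.

Section NonVanishing.
Variable K : numFieldType.

Lemma poly_nonroot (p : {poly K}) : p != 0 -> exists t, p.[t] != 0.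
Proof.
move=> p0; pose rs : seq K := [seq i%:R | i <- iota 0 (size p)].
have /allPn [t _ tp] : ~~ all (root p) rs.
  apply/negP => ar; have := max_poly_roots p0 ar.
  rewrite map_inj_uniq ?iota_uniq => [/(_ isT)|]; last exact: mulrIn (oner_neq0 K).
  by rewrite size_map size_iota ltnn.
by exists t.
Qed.

(** Kronecker substitution: with B above every exponent, X_i -> t^(B^i) sends the distinct monomials
    of [p] to distinct powers of t, which reduces to one variable. *)
Lemma mpoly_nonroot (n : nat) (p : {mpoly K[n]}) : p != 0 -> exists v, p.@[v] != 0.
Proof.
move=> p0; pose B := msize p; pose k (m : 'X_{1..n}) := (\sum_(i < n) m i * B ^ i)%N.
pose P : {poly K} := \sum_(m <- msupp p) p@_m *: 'X^(k m).
have entries (m : 'X_{1..n}) : m \in msupp p -> forall i, (m i < B)%N.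
  move=> mp i; apply: leq_ltn_trans (msize_mdeg_lt mp).
  by rewrite mdegE (bigD1 i) //= leq_addr.
have kinj : {in msupp p &, injective k}.
  move=> m1 m2 h1 h2 e; apply/mnmP; exact: base_digits_inj (entries _ h1) (entries _ h2) e.
have P0 : P != 0.
  apply/eqP => /(congr1 (fun q : {poly K} => q`_(k (mlead p)))); rewrite coef0 coef_sum.
  rewrite (bigD1_seq (mlead p)) ?msupp_uniq ?mlead_supp //= coefZ coefXn eqxx mulr1.
  rewrite big_seq_cond big1 ?addr0 => [/eqP|m /andP[mp ne]]; first by rewrite mleadc_eq0 (negPf p0).
  rewrite coefZ coefXn; case: eqP => [e|_]; last by rewrite mulr0.
  by move: ne; rewrite (kinj _ _ (mlead_supp p0) mp e) eqxx.
have [t Pt] := poly_nonroot P0.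
exists (fun i => t ^+ (B ^ i)); move: Pt; rewrite mevalE horner_sum.
congr (_ != 0); apply: eq_bigr => m _; rewrite hornerZ hornerXn /k -prodrXr.
by congr (_ * _); apply: eq_bigr => i _; rewrite -exprM mulnC.
Qed.

Lemma mpoly_eq0_dense (n : nat) (p D : {mpoly K[n]}) :
  D != 0 -> (forall v, D.@[v] != 0 -> p.@[v] = 0) -> p = 0.
Proof.
move=> D0 h; apply/eqP; apply/negPn/negP => p0.
have [v] := mpoly_nonroot (mulf_neq0 p0 D0).
by rewrite mevalM mulf_eq0 negb_or => /andP[pv /h e]; rewrite e eqxx in pv.
Qed.

Lemma mpoly_mulrn_eq0 (n k : nat) (p : {mpoly K[n]}) : (p *+ k.+1 == 0) = (p == 0).
Proof.
apply/eqP/eqP => [e|->]; last by rewrite mul0rn.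
apply/mpolyP => m; move/mpolyP/(_ m): e; rewrite mcoeff0 mcoeffMn => /eqP.
by rewrite mulrn_eq0 => /eqP.
Qed.

End NonVanishing.

Section LinearExtension.
Variables (K : fieldType) (n : nat) (V : lmodType K) (w : 'X_{1..n} -> V).

Definition mlin (D : {mpoly K[n]}) : V := \sum_(m <- msupp D) D@_m *: w m.

Lemma mlinwE k D : (msize D <= k)%N -> mlin D = \sum_(m : 'X_{1..n < k}) D@_m *: w m.
Proof.
move=> le; pose I : subFinType _ := 'X_{1..n < k}.
rewrite /mlin (big_mksub I) ?msupp_uniq //=; last first.
  by move=> x /msize_mdeg_lt /leq_trans; apply.
rewrite big_rmcond //= => j /memN_msupp_eq0 ->; by rewrite scale0r.
Qed.

Lemma mlin_is_linear : linear mlin.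
Proof.
move=> c p q; pose k := maxn (msize (c *: p + q)) (maxn (msize p) (msize q)).
rewrite !(@mlinwE k) ?leq_maxl // /k ?leq_max ?leqnn ?orbT //.
rewrite scaler_sumr -big_split; apply: eq_bigr => m _ /=.
by rewrite linearP scalerDl scalerA.
Qed.

HB.instance Definition _ := GRing.isLinear.Build K {mpoly K[n]} V _ mlin mlin_is_linear.

Lemma mlinX m : mlin 'X_[m] = w m.
Proof. by rewrite /mlin msuppX big_seq1 mcoeffX eqxx scale1r. Qed.

End LinearExtension.

Lemma mpoly_lin_ind (K : fieldType) (n : nat) (P : {mpoly K[n]} -> Prop) :
  P 0 -> (forall p q, P p -> P q -> P (p + q)) -> (forall c p, P p -> P (c *: p)) ->
  (forall a, P 'X_[a]) -> forall p, P p.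
Proof.
move=> P0 PD PZ PX p; rewrite [p]mpolyE; elim/big_ind: _ => // a _; exact/PZ.
Qed.

Section IdealGen.
Variables (K : fieldType) (n : nat) (G : {mpoly K[n]} -> Prop).

Lemma ideal_genP g : G g -> ideal_gen G g.
Proof.
move=> Gg; exists 1%N, (fun=> 1), (fun=> g); split=> //.
by rewrite big_ord1 mul1r.
Qed.

Lemma ideal_gen0 : ideal_gen G 0.
Proof. by exists 0%N, (fun=> 0), (fun=> 0); split=> [[]|]//; rewrite big_ord0. Qed.

Lemma ideal_genD p q : ideal_gen G p -> ideal_gen G q -> ideal_gen G (p + q).
Proof.
move=> [r [a [g [Gg ->]]]] [s [b [h [Gh ->]]]].
pose c T (x : 'I_r -> T) (y : 'I_s -> T) i :=
  match fintype.split i with inl j => x j | inr j => y j end.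
exists (r + s)%N, (c _ a b), (c _ g h); split.
  by move=> i; rewrite /c; case: fintype.split => j.
rewrite big_split_ord /=; congr (_ + _); apply: eq_bigr => i _; rewrite /c.
  by rewrite (unsplitK (inl i)).
by rewrite (unsplitK (inr i)).
Qed.

Lemma ideal_genM p q : ideal_gen G q -> ideal_gen G (p * q).
Proof.
move=> [r [a [g [Gg ->]]]]; exists r, (fun i => p * a i), g; split=> //.
by rewrite mulr_sumr; apply: eq_bigr => i _; rewrite mulrA.
Qed.

Lemma ideal_gen_ind (P : {mpoly K[n]} -> Prop) :
  P 0 -> (forall p q, P p -> P q -> P (p + q)) -> (forall a g, G g -> P (a * g)) ->
  forall p, ideal_gen G p -> P p.
Proof.
move=> P0 PD PG p [r [a [g [Gg ->]]]]; elim/big_ind: _ => // i _; exact: PG.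
Qed.

Lemma ideal_genN p : ideal_gen G p -> ideal_gen G (- p).
Proof. by move=> h; rewrite -mulN1r; apply: ideal_genM. Qed.

Lemma ideal_genB p q : ideal_gen G p -> ideal_gen G q -> ideal_gen G (p - q).
Proof. by move=> hp hq; apply: ideal_genD => //; apply: ideal_genN. Qed.

Lemma ideal_genZ c p : ideal_gen G p -> ideal_gen G (c *: p).
Proof. by rewrite -mul_mpolyC; apply: ideal_genM. Qed.

Lemma ideal_gen_sum (I : Type) (s : seq I) (P : pred I) (F : I -> {mpoly K[n]}) :
  (forall i, P i -> ideal_gen G (F i)) -> ideal_gen G (\sum_(i <- s | P i) F i).
Proof.
move=> h; elim/big_ind: _ => //; [exact: ideal_gen0|exact: ideal_genD].
Qed.

End IdealGen.

Lemma comp_mpolyXt (R : comNzRingType) (n k : nat) (t : n.-tuple {mpoly R[k]}) i :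
  'X_i \mPo t = tnth t i.
Proof. by rewrite comp_mpolyXU (tnth_nth 0). Qed.

Section Translation.
Variables (K : numFieldType) (n : nat).

Definition translate (a : 'I_n -> K) : n.-tuple {mpoly K[n]} :=
  [tuple 'X_i + (a i)%:MP | i < n].

Lemma mderiv_translate (a : 'I_n -> K) i (p : {mpoly K[n]}) :
  (p \mPo translate a)^`M(i) = p^`M(i) \mPo translate a.
Proof.
elim/mpoly_ring_ind: p => [c|j|p q IHp IHq|p q IHp IHq].
- by rewrite comp_mpolyC !mderivC comp_mpoly0.
- rewrite comp_mpolyXt tnth_mktuple mderivD mderivC addr0 !mderivX comp_mpolyZ.
  have [->|ne] := eqVneq j i.
    have -> : (U_(i) - U_(i) = 0 :> 'X_{1..n})%MM by apply/mnmP => l; rewrite mnmBE mnm0E subnn.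
    by rewrite mpolyX0 comp_mpoly1.
  by rewrite !mnm1E (negPf ne) !scale0r.
- by rewrite comp_mpolyD !mderivD IHp IHq comp_mpolyD.
- by rewrite rmorphM /= !mderivM IHp IHq comp_mpolyD !rmorphM.
Qed.

Lemma meval_translate a v (p : {mpoly K[n]}) :
  (p \mPo translate a).@[v] = p.@[fun i => v i + a i].
Proof.
rewrite comp_mpoly_meval; apply: meval_eq => i.
by rewrite tnth_mktuple mevalD mevalXU mevalC.
Qed.

End Translation.

(* The restriction of [p] to the line through the generic point with direction
   [o], as a polynomial in the parameter of the line. *)
Section GenericLine.
Variables (K : numFieldType) (n : nat) (o : 'I_n -> K).

Definition generic_line : {mpoly K[n]} -> {poly {mpoly K[n]}} :=
  mmap (polyC \o @mpolyC n K) (fun i => ('X_i)%:P + (o i)%:MP *: 'X).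

HB.instance Definition _ := GRing.RMorphism.on generic_line.

Lemma generic_lineD p q : generic_line (p + q) = generic_line p + generic_line q.
Proof. exact: mmapD. Qed.

Lemma generic_lineM p q : generic_line (p * q) = generic_line p * generic_line q.
Proof. exact: (mmap_is_multiplicative _ _).1. Qed.

Lemma generic_lineC c : generic_line c%:MP = c%:MP%:P.
Proof. exact: mmapC. Qed.

Lemma generic_lineXm m :
  generic_line 'X_[m] = \prod_i (('X_i)%:P + (o i)%:MP *: 'X) ^+ m i.
Proof. exact: mmapX. Qed.

Lemma generic_lineX i : generic_line 'X_i = ('X_i)%:P + (o i)%:MP *: 'X.
Proof. by rewrite /generic_line mmapX mmap1U. Qed.

Lemma horner_generic_line p t :
  (generic_line p).[t%:MP] = p \mPo translate (fun i => t * o i).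
Proof.
elim/mpoly_ring_ind: p => [c|j|p q IHp IHq|p q IHp IHq].
- by rewrite generic_lineC hornerC comp_mpolyC.
- rewrite generic_lineX hornerD hornerC hornerZ hornerX comp_mpolyXt tnth_mktuple.
  by rewrite mulrC mpolyCM.
- by rewrite generic_lineD hornerD comp_mpolyD; congr (_ + _).
- by rewrite generic_lineM hornerM rmorphM; congr (_ * _).
Qed.

Lemma generic_line0 p : (generic_line p).[0] = p.
Proof.
rewrite -(mpolyC0 n) horner_generic_line -[RHS]comp_mpoly_id.
by congr (_ \mPo _); apply: eq_mktuple => i; rewrite mul0r mpolyC0 addr0.
Qed.

Lemma meval_generic_line p v t :
  (map_poly (meval v) (generic_line p)).[t] = p.@[fun i => v i + t * o i].
Proof.
rewrite -[t in LHS](mevalC v) horner_map horner_generic_line.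
exact: meval_translate.
Qed.

(** A degree bound together with the coefficient at that bound, which may be zero: unlike an exact
    degree, this passes to sums and products without side conditions. *)
Let deg_le (a : nat) (c : K) (p : {poly {mpoly K[n]}}) :=
  (size p <= a.+1)%N /\ p`_a = c%:MP.

Let deg_leM a b c d p q : deg_le a c p -> deg_le b d q -> deg_le (a + b) (c * d) (p * q).
Proof.
move=> [sp pa] [sq qb]; split.
  apply: leq_trans (size_polyMleq _ _) _.
  by rewrite -subn1 leq_subLR add1n -addSn -addnS leq_add.
rewrite coefM; have ai : (a < (a + b).+1)%N by lia.
rewrite (bigD1 (Ordinal ai)) //= addKn pa qb -mpolyCM big1 ?addr0 // => -[j jl] ne.
have {}ne : j != a by apply: contra ne => /eqP e; apply/eqP/val_inj.
rewrite /=; case: (ltngtP j a) ne => // ja _.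
  by rewrite [q`__]nth_default ?mulr0 // (leq_trans sq) //; lia.
by rewrite [p`__]nth_default ?mul0r // (leq_trans sp).
Qed.

Let deg_leX a c p k : deg_le a c p -> deg_le (k * a) (c ^+ k) (p ^+ k).
Proof.
move=> h; elim: k => [|k IH]; last by rewrite !exprS mulSn; apply: deg_leM.
by rewrite !expr0 mul0n; split; rewrite ?size_poly1 // coef1 mpolyC1.
Qed.

Lemma generic_line_homog d p : p \is d.-homog ->
  (size (generic_line p) <= d.+1)%N /\ (generic_line p)`_d = (p.@[o])%:MP.
Proof.
move=> hp; suff: deg_le d p.@[o] (generic_line p) by [].
rewrite {2}[p]mpolyE rmorph_sum mevalE.
have mono m : mdeg m = d ->
    deg_le d (\prod_i o i ^+ m i) (generic_line 'X_[m]).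
  move=> <-; rewrite mdegE generic_lineXm.
  apply: (big_ind3 (fun a c p => deg_le a c p)).
  - by split; rewrite ?size_poly1 // coef1 mpolyC1.
  - by move=> *; apply: deg_leM.
  move=> i _; have := @deg_leX 1 (o i) (('X_i)%:P + (o i)%:MP *: 'X) (m i); rewrite muln1; apply; split.
    apply: leq_trans (size_polyD _ _) _; rewrite geq_max.
    rewrite (leq_trans (size_polyC_leq1 _)) //=.
    by apply: leq_trans (size_scale_leq _ _) _; rewrite size_polyX.
  by rewrite coefD coefC coefZ coefX /= add0r mulr1.
move/dhomogP: hp => hp; rewrite !big_seq.
elim/big_ind2: _ => [|x1 x2 y1 y2 [s1 e1] [s2 e2]|m mp].
- by split; rewrite ?size_poly0 // coef0 mpolyC0.
- split; last by rewrite coefD e1 e2 mpolyCD.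
  by apply: leq_trans (size_polyD _ _) _; rewrite geq_max s1 s2.
rewrite -mul_mpolyC /= generic_lineM -[d]add0n; apply: deg_leM; last exact/mono/hp.
by rewrite generic_lineC; split; rewrite ?size_polyC_leq1 // coefC.
Qed.

End GenericLine.

(** * Divisibility by the equation of a smooth hypersurface *)

Section SmoothHypersurface.
Variables (K : numClosedFieldType) (n : nat).
Hypothesis n_gt1 : (1 < n)%N.

(** Where L is nonzero at v, it is nonzero on the whole line through v with direction o, so that
    line misses the origin and its points represent points of projective space. *)
Lemma vanishing_linear_form (o : 'I_n -> K) :
  exists L : {mpoly K[n]},
    [/\ L != 0, L.@[fun=> 0] = 0 & forall v t, L.@[fun i => v i + t * o i] = L.@[v]].
Proof.
pose i0 : 'I_n := Ordinal (ltnW n_gt1); pose i1 : 'I_n := Ordinal n_gt1.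
have [o0|o0] := eqVneq (o i0) 0.
  exists 'X_i0; split; rewrite ?mevalXU //.
    by apply/eqP => /mpolyP/(_ U_(i0)%MM); rewrite mcoeffXU mcoeff0 eqxx => /eqP; rewrite oner_eq0.
  by move=> v t; rewrite !mevalXU o0 mulr0 addr0.
exists (o i0 *: 'X_i1 - o i1 *: 'X_i0); split.
- apply/eqP => /mpolyP/(_ U_(i1)%MM).
  rewrite mcoeffB !mcoeffZ !mcoeffXU mcoeff0 eqxx /= mulr1 mulr0 subr0.
  by move/eqP; rewrite (negPf o0).
- by rewrite mevalB !mevalZ !mevalXU !mulr0 subrr.
- by move=> v t; rewrite !mevalB !mevalZ !mevalXU; ring.
Qed.

(* A root of a repeated factor of [f] on the generic line is a singular point. *)
Lemma generic_line_separable (f : {mpoly K[n]}) (o : 'I_n -> K) :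
  f != 0 ->
  (forall v, nonzero_vec v -> f.@[v] = 0 -> exists i, (f^`M(i)).@[v] != 0) ->
  separable_poly (generic_line o f).
Proof.
move=> f0 smooth; set F := generic_line o f.
have F0 : F != 0.
  by apply: contra_neq f0 => e; rewrite -(generic_line0 o f) -/F e horner0.
apply/separable_polyP; split=> [u v uvF|u _ su]; last first.
  apply/eqP => /(congr1 (fun p : {poly _} => p`_(size u).-2)).
  rewrite coef0 coef_deriv; case e: (size u) su => [|[|k]] // _ /=.
  move=> /eqP; rewrite mpoly_mulrn_eq0 => /eqP uk.
  have : lead_coef u == 0 by rewrite /lead_coef e /= uk.
  by rewrite lead_coef_eq0 => /eqP u0; rewrite u0 size_poly0 in e.
apply/negPn/negP => ncop; set g := gcdp u v.
have u0 : u != 0.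
  by apply: contraNneq F0 => u0; move: uvF; rewrite u0 mul0r dvd0p.
have sg : (1 < size g)%N.
  have g0 : g != 0 by rewrite gcdp_eq0 (negPf u0).
  by move: ncop; rewrite /coprimep -/g; move: g0; rewrite -size_poly_eq0; lia.
have g0 : g != 0 by rewrite -size_poly_gt0 ltnW.
have : g * g %| F by apply: dvdp_trans uvF; apply: dvdp_mul; [exact: dvdp_gcdl|exact: dvdp_gcdr].
case/Pdiv.Idomain.dvdpP => -[c e] /= c0 def_F.
have [L [L0 L00 Lo]] := vanishing_linear_form o.
have lg0 : lead_coef g != 0 by rewrite lead_coef_eq0.
(* At [v0] the pseudo-division factor [c] and the leading coefficient of [g] survive, so [g]
   specialises without loss of degree and has a root t; and the line through [v0] misses the
   origin. *)
have [v0] := mpoly_nonroot (mulf_neq0 (mulf_neq0 c0 lg0) L0).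
rewrite !mevalM !mulf_eq0 !negb_or => /andP[/andP[cv lgv] Lv].
have sgv : size (map_poly (meval v0) g) = size g by rewrite size_map_poly_id0.
have /closed_rootP [t /eqP gt0] : size (map_poly (meval v0) g) != 1%N.
  by rewrite sgv neq_ltn sg orbT.
pose w i := v0 i + t * o i.
have w0 : nonzero_vec w.
  have [i wi|w0] := pickP (fun i => w i != 0); first by exists i.
  move: Lv; rewrite -(Lo v0 t) (meval_eq (v2 := fun=> 0)) ?L00 ?eqxx // => i.
  by apply/eqP; move: (w0 i); rewrite /= => /negbFE.
pose T := translate (fun i => t * o i).
have gv : (g.[t%:MP]).@[v0] = 0 by rewrite -horner_map /= mevalC.
have def_f : c * (f \mPo T) = e.[t%:MP] * (g.[t%:MP] * g.[t%:MP]).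
  have := congr1 (horner^~ t%:MP) def_F; rewrite /= hornerZ !hornerM.
  by rewrite horner_generic_line.
have fw : f.@[w] = 0.
  have := congr1 (meval v0) def_f; rewrite !mevalM gv !mulr0 meval_translate.
  by move/eqP; rewrite mulf_eq0 (negPf cv) => /eqP.
have [i /eqP[]] := smooth w w0 fw.
(* Every term of the derivative of e g^2 still contains g, and f itself vanishes at w, so all
   partial derivatives of f vanish there. *)
have := congr1 (fun p => (mderiv i p).@[v0]) def_f.
rewrite !mderivM !mevalD !mevalM !mevalD !mevalM gv mderiv_translate !meval_translate fw.
rewrite !(mulr0, mul0r, addr0, add0r) => /eqP.
by rewrite mulf_eq0 (negPf cv) => /eqP.
Qed.

(* Divide [h] by [f] on the generic line: on every line where [f] is separable
   the remainder has more roots than its degree. *)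
Lemma smooth_hypersurface_dvd (d : nat) (f h : {mpoly K[n]}) :
  (1 < d)%N -> f != 0 -> f \is d.-homog ->
  (forall v, nonzero_vec v -> f.@[v] = 0 -> exists i, (f^`M(i)).@[v] != 0) ->
  (forall v, nonzero_vec v -> f.@[v] = 0 -> h.@[v] = 0) ->
  exists q, h = q * f.
Proof.
move=> d1 f0 hf smooth van.
have [o fo] := mpoly_nonroot f0.
have [sF Fd] := generic_line_homog o hf; set F := generic_line o f in sF Fd.
have sepF : separable_poly F by apply: generic_line_separable.
have szF : size F = d.+1.
  apply/eqP; rewrite eqn_leq sF ltnNge; apply/negP => /(nth_default 0).
  by rewrite Fd => /eqP; rewrite mpolyC_eq0 (negPf fo).
pose c : {mpoly K[n]} := (f.@[o])^-1%:MP.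
have c0 : c != 0 by rewrite mpolyC_eq0 invr_eq0.
have mF : c *: F \is monic.
  by rewrite monicE lead_coefZ /lead_coef szF Fd -mpolyCM mulVf // mpolyC1.
have szcF : size (c *: F) = d.+1 by rewrite size_scale.
pose H := generic_line o h.
have def_H := Pdiv.RingMonic.rdivp_eq mF H.
set q := Pdiv.Ring.rdivp _ _ in def_H; set r := Pdiv.Ring.rmodp _ _ in def_H.
have sr : (size r < d.+1)%N by rewrite -szcF Pdiv.Ring.ltn_rmodpN0 // monic_neq0.
suff r0 : r = 0.
  exists (q.[0] * c); rewrite -(generic_line0 o h) -/H def_H r0 addr0 hornerM hornerZ.
  by rewrite generic_line0 mulrA.
(* Nonzero since F is separable. Where it does not vanish at v, the Bezout relation it provides
   specialises, so that the line through v meets f = 0 in d distinct points. *)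
pose D := resultant F F^`().
have D0 : D != 0.
  rewrite resultant_eq0; move: sepF; rewrite unlock /coprimep => /eqP ->.
  by rewrite ltnn.
have [L [L0 L00 Lo]] := vanishing_linear_form o.
apply/polyP => j; rewrite coef0.
apply: (mpoly_eq0_dense (mulf_neq0 D0 L0)) => v.
rewrite mevalM mulf_eq0 negb_or => /andP[Dv Lv].
pose ev := map_poly (meval v).
suff : ev r = 0 by move/polyP/(_ j); rewrite coef_map coef0.
have sFv : size (ev F) = d.+1.
  by rewrite /ev size_map_poly_id0 // /lead_coef szF Fd mevalC.
have F0 : ev F != 0 by rewrite -size_poly_eq0 sFv.
have sepFv : separable_poly (ev F).
  have sF' : (1 < size F^`())%N.
    have d0 : (0 < d)%N by apply: ltnW.
    rewrite (leq_trans d1) // leqNgt; apply/negP => lt.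
    have /eqP : F^`()`_d.-1 = 0 by apply: nth_default; rewrite -ltnS prednK.
    rewrite coef_deriv prednK // Fd -(prednK d0) mpoly_mulrn_eq0.
    by rewrite mpolyC_eq0 (negPf fo).
  have sF1 : (1 < size F)%N by rewrite szF ltnS ltnW.
  have [[a b] _ def_D] := resultant_in_ideal sF1 sF'.
  rewrite unlock /ev; apply/Bezout_eq1_coprimepP.
  exists (D.@[v]^-1 *: map_poly (meval v) a, D.@[v]^-1 *: map_poly (meval v) b) => /=.
  have := congr1 (map_poly (meval v)) def_D.
  rewrite /= map_polyC rmorphD !rmorphM /= deriv_map -!scalerAl -scalerDr => <-.
  by rewrite -mul_polyC -polyCM mulVf.
have [rs def_Fv] := closed_field_poly_normal (ev F).
have lc0 : lead_coef (ev F) != 0 by rewrite lead_coef_eq0.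
have urs : uniq rs.
  move: sepFv; rewrite def_Fv (eqp_separable (eqp_scale _ lc0)).
  by rewrite separable_prod_XsubC.
have srs : size rs = d.
  by move: sFv; rewrite def_Fv size_scale // size_prod_XsubC => -[].
apply/eqP/negPn/negP => r0.
have /max_poly_roots : all (root (ev r)) rs; last first.
  move/(_ r0 urs); rewrite srs leqNgt ltnS => /negP[].
  apply: leq_trans (size_poly _ _) _; exact: sr.
apply/allP => t trs.
have Ft : (ev F).[t] = 0.
  by apply/eqP; rewrite -/(root _ _) def_Fv rootZ // root_prod_XsubC.
have wv : nonzero_vec (fun i => v i + t * o i).
  have [i wi|w0] := pickP (fun i => v i + t * o i != 0); first by exists i.
  move: Lv; rewrite -(Lo v t) (meval_eq (v2 := fun=> 0)) ?L00 ?eqxx // => i.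
  by apply/eqP; move: (w0 i); rewrite /= => /negbFE.
have ht : (ev H).[t] = 0.
  by rewrite meval_generic_line; apply: van => //; rewrite -meval_generic_line.
rewrite /root; move: ht; rewrite /ev def_H rmorphD rmorphM /= hornerD hornerM.
by rewrite map_polyZ hornerZ -/ev Ft !mulr0 add0r => ->.
Qed.

End SmoothHypersurface.

(** * Two ternary forms of degree m *)

Definition v0 : 'I_3 := @Ordinal 3 0 isT.
Definition v1 : 'I_3 := @Ordinal 3 1 isT.
Definition v2 : 'I_3 := @Ordinal 3 2 isT.

Lemma ord3P (P : 'I_3 -> Prop) : P v0 -> P v1 -> P v2 -> forall i, P i.
Proof.
move=> P0 P1 P2 [[|[|[|i]]] lti] //.
- by rewrite (_ : Ordinal lti = v0) //; apply: val_inj.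
- by rewrite (_ : Ordinal lti = v1) //; apply: val_inj.
- by rewrite (_ : Ordinal lti = v2) //; apply: val_inj.
Qed.

Definition mnm3 (i j k : nat) : 'X_{1..3} := [multinom nth 0%N [:: i; j; k] l | l < 3].

Lemma mnm3E i j k : (mnm3 i j k v0 = i) * (mnm3 i j k v1 = j) * (mnm3 i j k v2 = k).
Proof. by rewrite !mnmE. Qed.

Lemma mnm3P (a b : 'X_{1..3}) : a v0 = b v0 -> a v1 = b v1 -> a v2 = b v2 -> a = b.
Proof. by move=> h0 h1 h2; apply/mnmP; elim/ord3P. Qed.

Lemma mnm3_eta (a : 'X_{1..3}) : a = mnm3 (a v0) (a v1) (a v2).
Proof. by apply: mnm3P; rewrite mnm3E. Qed.

Lemma mdeg3 (a : 'X_{1..3}) : mdeg a = (a v0 + a v1 + a v2)%N.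
Proof.
rewrite mdegE !big_ord_recl big_ord0 addn0 addnA.
by congr (a _ + a _ + a _)%N; apply: val_inj.
Qed.

Lemma mdeg_mnm3 i j k : mdeg (mnm3 i j k) = (i + j + k)%N.
Proof. by rewrite mdeg3 !mnm3E. Qed.

Lemma mnm3D i j k i' j' k' :
  (mnm3 i j k + mnm3 i' j' k')%MM = mnm3 (i + i') (j + j') (k + k').
Proof. by apply: mnm3P; rewrite mnmDE !mnm3E. Qed.

Lemma U3E : (U_(v0)%MM = mnm3 1 0 0) * (U_(v1)%MM = mnm3 0 1 0) * (U_(v2)%MM = mnm3 0 0 1).
Proof. by do !split; apply: mnm3P; rewrite mnm1E mnm3E. Qed.

Section HomogCoordinates.
Variables (R : comNzRingType) (e : nat).
Notation mons := (ternary_monomials e).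

Lemma mem_ternary_monomials a : (a \in mons) = (mdeg a == e).
Proof. by rewrite -basis_cover. Qed.

Lemma ternary_monomials_uniq : uniq mons.
Proof. exact: uniq_basis. Qed.

Definition mon_at (i : 'I_(size mons)) : 'X_{1..3} := nth 0%MM mons i.

Lemma mdeg_mon_at i : mdeg (mon_at i) = e.
Proof. by apply/eqP; rewrite -mem_ternary_monomials mem_nth. Qed.

Lemma mon_at_inj : injective mon_at.
Proof. by move=> i j /eqP; rewrite nth_uniq ?ternary_monomials_uniq // => /eqP/val_inj. Qed.

Lemma mon_atP a : mdeg a = e -> exists i, mon_at i = a.
Proof.
move/eqP; rewrite -mem_ternary_monomials => ain.
by move: (ain); rewrite -index_mem => lti; exists (Ordinal lti); rewrite /mon_at nth_index.
Qed.

Definition crd (h : {mpoly R[3]}) : 'rV[R]_(size mons) := \row_i h@_(mon_at i).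
Definition pol (r : 'rV[R]_(size mons)) : {mpoly R[3]} := \sum_i r 0 i *: 'X_[mon_at i].

Lemma pol_homog r : pol r \is e.-homog.
Proof. by apply: rpred_sum => i _; apply: rpredZ; rewrite dhomogX; apply/eqP/mdeg_mon_at. Qed.

Lemma polK r : crd (pol r) = r.
Proof.
apply/rowP => i; rewrite mxE /pol raddf_sum (bigD1 i) //= mcoeffZ mcoeffX eqxx mulr1.
rewrite big1 ?addr0 // => j ne; rewrite mcoeffZ mcoeffX (inj_eq mon_at_inj) (negPf ne).
by rewrite mulr0.
Qed.

Lemma crdK h : h \is e.-homog -> pol (crd h) = h.
Proof.
move=> hh; apply/mpolyP => a; have [/mon_atP [i <-]|ne] := eqVneq (mdeg a) e.
  by have /rowP/(_ i) := polK (crd h); rewrite !mxE.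
by rewrite !(dhomog_nemf_coeff _ ne) // pol_homog.
Qed.

Lemma crdD h h' : crd (h + h') = crd h + crd h'.
Proof. by apply/rowP => i; rewrite !mxE mcoeffD. Qed.

Lemma crdZ c h : crd (c *: h) = c *: crd h.
Proof. by apply/rowP => i; rewrite !mxE mcoeffZ. Qed.

Lemma crd_sum (I : Type) (s : seq I) (F : I -> {mpoly R[3]}) :
  crd (\sum_(i <- s) F i) = \sum_(i <- s) crd (F i).
Proof.
elim: s => [|i s IH]; last by rewrite !big_cons crdD IH.
by rewrite !big_nil; apply/rowP => i; rewrite !mxE mcoeff0.
Qed.

End HomogCoordinates.

Section Psi.
Variables (R : comNzRingType) (m : nat) (g1 g2 : {mpoly R[3]}).

(* Replaces x^m by g1 and y^m by g2. For general g1, g2 its linear extension is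
   bijective: K[x, y, z] is free over K[g1, g2, z] on the x^i y^j, i, j < m. *)
Definition psi_gen (a : 'X_{1..3}) : {mpoly R[3]} :=
  'X_[mnm3 (a v0 %% m) (a v1 %% m) (a v2)] * g1 ^+ (a v0 %/ m) * g2 ^+ (a v1 %/ m).

Definition psi_mx_gen (e : nat) : 'M[R]_(size (ternary_monomials e)) :=
  \matrix_i crd e (psi_gen (mon_at i)).

End Psi.

Section CompleteIntersection.
Variables (K : fieldType) (m : nat) (g1 g2 : {mpoly K[3]}).
Hypothesis m_gt0 : (0 < m)%N.
Hypotheses (g1_homog : g1 \is m.-homog) (g2_homog : g2 \is m.-homog).

Implicit Types a b : 'X_{1..3}.

Local Notation psi := (psi_gen m g1 g2).
Local Notation psi_mx := (psi_mx_gen m g1 g2).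

Definition Psi : {mpoly K[3]} -> {mpoly K[3]} := mlin psi.
HB.instance Definition _ := GRing.Linear.on Psi.

Definition gs_ideal : {mpoly K[3]} -> Prop := ideal_gen (fun Q => Q = g1 \/ Q = g2).

Lemma PsiX a : Psi 'X_[a] = psi a. Proof. exact: mlinX. Qed.

Lemma psi_std a : (a v0 < m)%N -> (a v1 < m)%N -> psi a = 'X_[a].
Proof.
by move=> h0 h1; rewrite /psi_gen !modn_small // !divn_small // !expr0 !mulr1 -mnm3_eta.
Qed.

Lemma psi_g1 a : psi (mnm3 m 0 0 + a)%MM = g1 * psi a.
Proof.
rewrite /psi_gen !mnmDE !mnm3E !add0n modnDl divnDl ?dvdnn // divnn m_gt0 add1n exprS.
by ring.
Qed.

Lemma psi_g2 a : psi (mnm3 0 m 0 + a)%MM = g2 * psi a.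
Proof.
rewrite /psi_gen !mnmDE !mnm3E !add0n modnDl divnDl ?dvdnn // divnn m_gt0 add1n exprS.
by ring.
Qed.

Lemma psi_z a : psi (U_(v2) + a)%MM = 'X_v2 * psi a.
Proof.
rewrite /psi_gen !mnmDE !U3E !mnm3E !add0n !mulrA -mpolyXD; congr ('X_[_] * _ * _).
by rewrite mnm3D.
Qed.

Lemma psi_homog a : psi a \is (mdeg a).-homog.
Proof.
have -> : mdeg a = (mdeg (mnm3 (a v0 %% m) (a v1 %% m) (a v2)) + m * (a v0 %/ m)
    + m * (a v1 %/ m))%N.
  rewrite mdeg_mnm3 mdeg3 {1}(divn_eq (a v0) m) {1}(divn_eq (a v1) m).
  by rewrite ![(m * _)%N]mulnC; lia.
by do 2 (apply: dhomogM; last exact: dhomogMn); rewrite dhomogX.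
Qed.

(** Applied to [psi_g1], [psi_g2] and [psi_z]: [Psi] turns multiplication by x^m, y^m, z into
    multiplication by g1, g2, z. *)
Lemma Psi_monM a g : (forall b, psi (a + b)%MM = g * psi b) ->
  forall h, Psi ('X_[a] * h) = g * Psi h.
Proof.
move=> ha; elim/mpoly_lin_ind => [|p q IHp IHq|c p IH|b].
- by rewrite mulr0 linear0 mulr0.
- by rewrite mulrDr !linearD /= IHp IHq mulrDr.
- by rewrite -scalerAr !linearZ /= IH scalerAr.
- by rewrite -mpolyXD !PsiX ha.
Qed.

Lemma Psi_g1 h : Psi ('X_[mnm3 m 0 0] * h) = g1 * Psi h.
Proof. exact/Psi_monM/psi_g1. Qed.

Lemma Psi_g2 h : Psi ('X_[mnm3 0 m 0] * h) = g2 * Psi h.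
Proof. exact/Psi_monM/psi_g2. Qed.

Lemma Psi_z h : Psi ('X_v2 * h) = 'X_v2 * Psi h.
Proof. exact/Psi_monM/psi_z. Qed.

Lemma Psi_pihomog e h : Psi (pihomog mdeg e h) = pihomog mdeg e (Psi h).
Proof.
elim/mpoly_lin_ind: h => [|p q IHp IHq|c p IH|b].
- by rewrite !linear0.
- by rewrite !linearD /= IHp IHq.
- by rewrite !linearZ /= IH.
rewrite pihomogX PsiX; case: eqP => [<-|/eqP ne].
  by rewrite PsiX pihomog_dE // psi_homog.
by rewrite linear0 (pihomog_ne0 _ (psi_homog b)) // eq_sym.
Qed.

Lemma Psi_homog e h : h \is e.-homog -> Psi h \is e.-homog.
Proof. by rewrite !homog_piE -Psi_pihomog => /eqP ->. Qed.

Lemma crd_Psi e h : h \is e.-homog -> crd e (Psi h) = crd e h *m psi_mx e.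
Proof.
move=> hh; rewrite -{1}(crdK hh) /pol linear_sum crd_sum mulmx_sum_row.
by apply: eq_bigr => i _; rewrite linearZ /= PsiX crdZ rowK.
Qed.

Lemma psi_mx_unitP e :
  (forall h, h \is e.-homog -> exists h', Psi h' = h) <-> psi_mx e \in unitmx.
Proof.
split=> [surj|u h hh].
  have sur i : exists h' : {mpoly K[3]}, crd e h' *m psi_mx e == delta_mx 0 i.
    have [h' def_h'] := surj (pol (delta_mx 0 i)) (pol_homog _).
    exists (pihomog mdeg e h'); rewrite -crd_Psi ?pihomogP // Psi_pihomog def_h'.
    by rewrite pihomog_dE ?pol_homog // polK.
  pose M := \matrix_i crd e (xchoose (sur i)).
  have : M *m psi_mx e = 1%:M.
    apply/row_matrixP => i; rewrite row_mul rowK row1; exact/eqP/(xchooseP (sur i)).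
  by case/mulmx1_unit.
exists (pol (crd e h *m invmx (psi_mx e))).
rewrite -[LHS](@crdK _ e) ?Psi_homog ?pol_homog // crd_Psi ?pol_homog //.
by rewrite polK mulmxKV // crdK.
Qed.

Definition in_Psi h := exists h', Psi h' = h.

Lemma in_PsiD h h' : in_Psi h -> in_Psi h' -> in_Psi (h + h').
Proof. by move=> [k <-] [k' <-]; exists (k + k'); rewrite linearD. Qed.

Lemma in_PsiZ c h : in_Psi h -> in_Psi (c *: h).
Proof. by move=> [k <-]; exists (c *: k); rewrite linearZ. Qed.

Lemma in_Psi_z k h : in_Psi h -> in_Psi ('X_v2 ^+ k * h).
Proof.
elim: k h => [|k IH] h hh; first by rewrite mul1r.
by rewrite exprSr -mulrA; apply: IH; case: hh => h' <-; exists ('X_v2 * h'); rewrite Psi_z.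
Qed.

Lemma in_Psi_g k l h : in_Psi h -> in_Psi (g1 ^+ k * (g2 ^+ l * h)).
Proof.
move=> hh; have {hh} : in_Psi (g2 ^+ l * h).
  elim: l => [|l [h' IH]]; first by rewrite mul1r.
  by exists ('X_[mnm3 0 m 0] * h'); rewrite Psi_g2 IH exprS mulrA.
elim: k => [|k IH] h0; first by rewrite mul1r.
by have [h' e] := IH h0; exists ('X_[mnm3 m 0 0] * h'); rewrite Psi_g1 e exprS mulrA.
Qed.

(** The image is stable under g1, g2 and z. For i, j < m the products of x^i y^j with x or y have
    degree at most 2m-1, hence lie in the image by hypothesis; so the image is stable under x and y
    too. It is then an ideal, and it contains 1. *)
Lemma Psi_surj_of_low :
  (forall e, (e < m.*2)%N -> psi_mx e \in unitmx) -> forall h, in_Psi h.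
Proof.
move=> low.
have lowX a : (mdeg a < m.*2)%N -> in_Psi 'X_[a].
  move=> /low/psi_mx_unitP; apply; by rewrite dhomogX.
have step (i : 'I_3) h : i != v2 -> in_Psi h -> in_Psi ('X_i * h).
  move=> i2 [h' <-]; elim/mpoly_lin_ind: h' => [|p q IHp IHq|c p IH|a].
  - by exists 0; rewrite !linear0 mulr0.
  - by rewrite linearD mulrDr; apply: in_PsiD.
  - by rewrite linearZ -scalerAr; apply: in_PsiZ.
  rewrite PsiX /psi_gen; set b := mnm3 _ _ _.
  pose b' := mnm3 (a v0 %% m) (a v1 %% m) 0.
  have -> : 'X_[b] = 'X_v2 ^+ a v2 * 'X_[b'] :> {mpoly K[3]}.
    rewrite mpolyXn -mpolyXD; congr 'X_[_]; apply: mnm3P;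
      by rewrite mnmDE mulmnE U3E /b /b' !mnm3E ?mul0n ?mul1n ?addn0 ?add0n.
  have -> : 'X_i * ('X_v2 ^+ a v2 * 'X_[b'] * g1 ^+ (a v0 %/ m) * g2 ^+ (a v1 %/ m)) =
    g1 ^+ (a v0 %/ m) * (g2 ^+ (a v1 %/ m) * ('X_v2 ^+ a v2 * 'X_[U_(i) + b'])).
    by rewrite mpolyXD; ring.
  apply: in_Psi_g; apply: in_Psi_z; apply: lowX.
  rewrite mdegD mdeg1 /b' mdeg_mnm3.
  by have := ltn_pmod (a v0) m_gt0; have := ltn_pmod (a v1) m_gt0; lia.
have mul p q : in_Psi q -> in_Psi (p * q).
  elim/mpoly_ring_ind: p q => [c q hq|i q hq|p p' IH IH' q hq|p p' IH IH' q hq].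
  - by rewrite mul_mpolyC; apply: in_PsiZ.
  - have [->|ne] := eqVneq i v2; first by have := @in_Psi_z 1 q hq; rewrite expr1.
    exact: step.
  - by rewrite mulrDl; apply: in_PsiD; [apply: IH|apply: IH'].
  - by rewrite -mulrA; apply/IH/IH'.
move=> h; rewrite -[h]mulr1; apply: mul; rewrite -mpolyX0; apply: lowX.
by rewrite mdeg0; lia.
Qed.

End CompleteIntersection.

(** * The quotient by two forms *)

Lemma pihomogM (K : fieldType) (n c e : nat) (p q : {mpoly K[n]}) : q \is c.-homog ->
  pihomog mdeg e (p * q) = if (c <= e)%N then pihomog mdeg (e - c) p * q else 0.
Proof.
move=> hq; have homp d (a : {mpoly K[n]}) : a \is d.-homog ->
    pihomog mdeg e (a * q) = if (c <= e)%N then pihomog mdeg (e - c) a * q else 0.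
  move=> ha; have haq := dhomogM ha hq.
  case: (leqP c e) => ce; last by rewrite (pihomog_ne0 _ haq) //; lia.
  have [de|ne] := eqVneq d (e - c)%N.
    have de' : (d + c)%N = e by rewrite de subnK.
    by rewrite -de (pihomog_dE ha) pihomog_dE // -de'.
  rewrite (pihomog_ne0 _ haq); last by lia.
  by rewrite (pihomog_ne0 _ ha) ?mul0r.
rewrite [p](pihomog_partitionE (mf := mdeg) (leqnn (msize p))) mulr_suml !linear_sum /=.
rewrite (eq_bigr _ (fun i _ => homp _ _ (pihomogP _ _ _))).
by case: leqP => _; rewrite ?mulr_suml // big1.
Qed.

Lemma ideal_gen_pihomog (K : fieldType) (n : nat) (G : {mpoly K[n]} -> Prop) :
  (forall g, G g -> exists c, g \is c.-homog) ->
  forall e p, ideal_gen G p -> ideal_gen G (pihomog mdeg e p).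
Proof.
move=> hG e p; elim/ideal_gen_ind => [|q q' hq hq'|a g Gg].
- by rewrite linear0; apply: ideal_gen0.
- by rewrite linearD; apply: ideal_genD.
have [c hc] := hG g Gg; rewrite (pihomogM _ _ hc); case: ifP => _; last exact: ideal_gen0.
exact/ideal_genM/ideal_genP.
Qed.

Section Basis.
Variables (R : comNzRingType) (m : nat).
Local Notation D := #|{: 'I_m * 'I_m}|.

Definition bexp (i : 'I_D) : 'I_m * 'I_m := enum_val i.
Definition bdeg (i : 'I_D) : nat := ((bexp i).1 + (bexp i).2)%N.
(* For general g1, g2 these form a basis of K[x, y, z]/(g1, g2) over K[z]. *)
Definition basis_mon (i : 'I_D) : {mpoly R[3]} := 'X_[mnm3 (bexp i).1 (bexp i).2 0].

Lemma bexp_inj i j : (bexp i).1 = (bexp j).1 :> nat -> (bexp i).2 = (bexp j).2 :> nat -> i = j.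
Proof.
move=> /val_inj e1 /val_inj e2; apply: enum_val_inj.
by rewrite -/(bexp i) -/(bexp j) [bexp i]surjective_pairing [bexp j]surjective_pairing e1 e2.
Qed.

Lemma basis_mon_homog i : basis_mon i \is (bdeg i).-homog.
Proof. by rewrite dhomogX /= mdeg_mnm3 addn0. Qed.

End Basis.

Section Residue.
Variables (K : fieldType) (m : nat) (g1 g2 : {mpoly K[3]}).
Hypothesis m_gt0 : (0 < m)%N.
Hypotheses (g1_homog : g1 \is m.-homog) (g2_homog : g2 \is m.-homog).
Hypothesis Psi_surj : forall h, in_Psi m g1 g2 h.

Implicit Types (a b : 'X_{1..3}) (h q : {mpoly K[3]}).
Local Notation Psi := (Psi m g1 g2).
Local Notation gs_ideal := (gs_ideal g1 g2).

(** In each degree [Psi] is given by a square matrix, so surjectivity forces injectivity. *)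
Lemma Psi_inj : injective Psi.
Proof.
suff inj0 h : Psi h = 0 -> h = 0.
  by move=> p q e; apply/eqP; rewrite -subr_eq0 (inj0 (p - q)) // linearB /= e subrr.
move=> h0; rewrite (pihomog_partitionE (mf := mdeg) (leqnn (msize h))).
apply: big1 => e _; set k := pihomog _ _ _.
have hk : k \is (e : nat).-homog by apply: pihomogP.
have /psi_mx_unitP u : forall k, k \is (e : nat).-homog -> exists k', Psi k' = k.
  by move=> k' _; apply: Psi_surj.
rewrite -(crdK hk) -[crd _ _](mulmxK (u m_gt0 g1_homog g2_homog)) -crd_Psi //.
rewrite /k Psi_pihomog // h0 linear0.
rewrite (_ : crd _ 0 = 0) ?mul0mx; last by apply/rowP => i; rewrite !mxE mcoeff0.
by rewrite /pol big1 // => i _; rewrite mxE scale0r.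
Qed.

Let Psi_surjb h : exists h', Psi h' == h.
Proof. by have [h' <-] := Psi_surj h; exists h'. Qed.

Definition Psi_inv h := xchoose (Psi_surjb h).

Lemma Psi_invK : cancel Psi_inv Psi.
Proof. by move=> h; apply/eqP/(xchooseP (Psi_surjb h)). Qed.

Lemma PsiK : cancel Psi Psi_inv.
Proof. by move=> h; apply: Psi_inj; rewrite Psi_invK. Qed.

Lemma Psi_inv_is_linear : linear Psi_inv.
Proof. by move=> c p q; apply: Psi_inj; rewrite linearP /= !Psi_invK. Qed.

HB.instance Definition _ := GRing.isLinear.Build K {mpoly K[3]} {mpoly K[3]} _
  Psi_inv Psi_inv_is_linear.

Lemma Psi_inv_homog e h : h \is e.-homog -> Psi_inv h \is e.-homog.
Proof.
move=> hh; rewrite homog_piE; apply/eqP/Psi_inj.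
by rewrite Psi_pihomog // Psi_invK pihomog_dE.
Qed.

Local Notation D := #|{: 'I_m * 'I_m}|.
Local Notation basis_mon := (@basis_mon K m).

(** The coordinates modulo (x^m, y^m, z - 1): the exponent of z is ignored, and monomials divisible
    by x^m or y^m are dropped. Composed with the inverse of [Psi] it becomes the coordinate map
    modulo (g1, g2, z - 1). *)
Definition cof h : 'rV[K]_D :=
  \row_i mlin (fun a => ((a v0 == (bexp i).1) && (a v1 == (bexp i).2))%:R : K^o) h.

Lemma cof_is_linear : linear cof.
Proof. by move=> c p q; apply/rowP => i; rewrite !mxE linearP. Qed.

HB.instance Definition _ := GRing.isLinear.Build K {mpoly K[3]} 'rV[K]_D _ cof cof_is_linear.

Lemma cofX a i : cof 'X_[a] 0 i = ((a v0 == (bexp i).1) && (a v1 == (bexp i).2))%:R.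
Proof. by rewrite mxE mlinX. Qed.

Definition Psi_coord h : 'rV[K]_D := cof (Psi_inv h).

Lemma Psi_coordE h : Psi_coord h = cof (Psi_inv h).
Proof. by []. Qed.

Lemma Psi_coord_is_linear : linear Psi_coord.
Proof. by move=> c p q; rewrite !Psi_coordE !linearP. Qed.

HB.instance Definition _ := GRing.isLinear.Build K {mpoly K[3]} 'rV[K]_D _
  Psi_coord Psi_coord_is_linear.

Lemma Psi_coord_z q : Psi_coord ('X_v2 * q) = Psi_coord q.
Proof.
rewrite !Psi_coordE (_ : Psi_inv ('X_v2 * q) = 'X_v2 * Psi_inv q); last first.
  by apply: Psi_inj; rewrite Psi_invK Psi_z Psi_invK.
move: (Psi_inv q) => h; elim/mpoly_lin_ind: h => [|p p' IHp IHq|c p IH|a].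
- by rewrite mulr0.
- by rewrite mulrDr !linearD /= IHp IHq.
- by rewrite -scalerAr !linearZ /= IH.
by rewrite -mpolyXD; apply/rowP => i; rewrite !cofX !mnmDE !mnm1E.
Qed.

Let cof_m1 h : cof ('X_[mnm3 m 0 0] * h) = 0.
Proof.
elim/mpoly_lin_ind: h => [|p p' IHp IHq|c p IH|a].
- by rewrite mulr0 linear0.
- by rewrite mulrDr !linearD /= IHp IHq addr0.
- by rewrite -scalerAr !linearZ /= IH scaler0.
rewrite -mpolyXD; apply/rowP => i; rewrite !cofX !mnmDE !mnm3E mxE.
by case: eqP => // e; have := ltn_ord (bexp i).1; rewrite -e; lia.
Qed.

Let cof_m2 h : cof ('X_[mnm3 0 m 0] * h) = 0.
Proof.
elim/mpoly_lin_ind: h => [|p p' IHp IHq|c p IH|a].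
- by rewrite mulr0 linear0.
- by rewrite mulrDr !linearD /= IHp IHq addr0.
- by rewrite -scalerAr !linearZ /= IH scaler0.
rewrite -mpolyXD; apply/rowP => i; rewrite !cofX !mnmDE !mnm3E mxE.
by case: (_ =P (bexp i).2 :> nat) => [e|]; rewrite ?andbF //;
   have := ltn_ord (bexp i).2; rewrite -e; lia.
Qed.

Lemma Psi_coord_ideal q : gs_ideal q -> Psi_coord q = 0.
Proof.
elim/ideal_gen_ind => [|p p' IHp IHq|p g].
- by rewrite linear0.
- by rewrite linearD /= IHp IHq addr0.
move=> eg; rewrite mulrC Psi_coordE; case: eg => ->.
  rewrite (_ : Psi_inv _ = 'X_[mnm3 m 0 0] * Psi_inv p) ?cof_m1 //.
  by apply: Psi_inj; rewrite Psi_invK Psi_g1 ?Psi_invK.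
rewrite (_ : Psi_inv _ = 'X_[mnm3 0 m 0] * Psi_inv p) ?cof_m2 //.
by apply: Psi_inj; rewrite Psi_invK Psi_g2 ?Psi_invK.
Qed.

Lemma Psi_coord_basis i : Psi_coord (basis_mon i) = delta_mx 0 i.
Proof.
rewrite Psi_coordE (_ : Psi_inv _ = basis_mon i); last first.
  by rewrite -[RHS]PsiK /basis_mon PsiX psi_std // mnm3E.
apply/rowP => j; rewrite cofX mxE !mnm3E eqxx /=.
have [->|ne] := eqVneq j i; first by rewrite !eqxx.
case: eqP => // e1; case: eqP => // e2; case/eqP: ne; exact: bexp_inj.
Qed.

Lemma Psi_coord_deg e q i : q \is e.-homog -> Psi_coord q 0 i != 0 -> (bdeg i <= e)%N.
Proof.
move/Psi_inv_homog => hq; rewrite leqNgt; apply: contra => lt.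
rewrite Psi_coordE mxE /mlin big_seq big1 // => a /(dhomog_mf hq) /=.
rewrite mdeg3 => ea; case: eqP => [e0|]; last by rewrite scaler0.
case: eqP => [e1|]; last by rewrite scaler0.
by move: lt; rewrite /bdeg -e0 -e1 -ea; lia.
Qed.

Lemma psi_nonstd a : ~~ ((a v0 < m) && (a v1 < m))%N -> gs_ideal (psi_gen m g1 g2 a).
Proof.
rewrite negb_and -!leqNgt => /orP[le|le].
  have -> : a = (mnm3 m 0 0 + (a - mnm3 m 0 0))%MM.
    by apply: mnm3P; rewrite mnmDE mnmBE !mnm3E ?subnKC ?subn0.
  by rewrite psi_g1 // mulrC; apply/ideal_genM/ideal_genP; left.
have -> : a = (mnm3 0 m 0 + (a - mnm3 0 m 0))%MM.
  by apply: mnm3P; rewrite mnmDE mnmBE !mnm3E ?subnKC ?subn0.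
by rewrite psi_g2 // mulrC; apply/ideal_genM/ideal_genP; right.
Qed.

(** Setting z = 1 loses nothing on forms of known degree, since the degree dictates the power of z
    that accompanies each basis monomial. The truncated subtraction is harmless: by [Psi_coord_deg]
    the coordinate vanishes when bdeg i > e. *)
Lemma Psi_coord_rep e q : q \is e.-homog ->
  gs_ideal (q - \sum_i Psi_coord q 0 i *: ('X_v2 ^+ (e - bdeg i) * basis_mon i)).
Proof.
move=> hq; have := Psi_inv_homog hq; rewrite -{2}(Psi_invK q) Psi_coordE.
move: (Psi_inv q) => h /dhomog_mf hh; rewrite [h]mpolyE big_seq.
elim/big_ind: _ => [|p p' IHp IHq|a /hh ea].
- by rewrite !linear0 sub0r big1 ?oppr0 => [|i _]; rewrite ?mxE ?scale0r //; apply: ideal_gen0.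
- have := ideal_genD IHp IHq; rewrite addrACA -opprD -big_split linearD /=.
  by under eq_bigr do rewrite -scalerDl; under [in X in _ -> X]eq_bigr do rewrite linearD mxE.
rewrite !linearZ /= (eq_bigr (fun i => h@_a *: (cof 'X_[a] 0 i *: ('X_v2 ^+ (e - bdeg i) * basis_mon i)))).
  rewrite -scaler_sumr -scalerBr; apply: ideal_genZ.
  rewrite PsiX; case std : ((a v0 < m) && (a v1 < m))%N; last first.
    rewrite big1 ?subr0 => [|i _]; first by apply: psi_nonstd; rewrite std.
    rewrite cofX; case: eqP => [e0|]; last by rewrite scale0r.
    case: eqP => [e1|]; last by rewrite scale0r.
    by move: std; rewrite e0 e1 !ltn_ord.
  have [a0 a1] := andP std; pose i : 'I_D := enum_rank (Ordinal a0, Ordinal a1).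
  have bi : bexp i = (Ordinal a0, Ordinal a1) by rewrite /bexp enum_rankK.
  rewrite (bigD1 i) //= big1 => [|j ne]; last first.
    rewrite cofX; case: eqP => [e0|]; last by rewrite scale0r.
    case: eqP => [e1|]; last by rewrite scale0r.
    by case/eqP: ne; apply: bexp_inj; rewrite bi.
  rewrite cofX bi !eqxx scale1r addr0 psi_std //.
  rewrite mpolyXn /basis_mon -mpolyXD bi (_ : (_ + _)%MM = a) ?subrr; first exact: ideal_gen0.
  apply: mnm3P; rewrite mnmDE mulmnE U3E !mnm3E ?mul0n ?mul1n ?addn0 //.
  by have := ea; rewrite /= mdeg3 /bdeg bi /=; lia.
by move=> i _; rewrite scalerA; congr (_ *: _); rewrite mxE.
Qed.

End Residue.

(* [co] is the coordinate map, killing z - 1, onto the free K-module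
   K[x, y, z]/(g1, g2, z - 1) with basis the monomials [basis_mon i]. *)
Definition is_coord (K : fieldType) (m : nat) (g1 g2 : {mpoly K[3]})
    (co : {mpoly K[3]} -> 'rV[K]_#|{: 'I_m * 'I_m}|) : Prop :=
  [/\ forall q, co ('X_v2 * q) = co q, forall q, gs_ideal g1 g2 q -> co q = 0,
      forall i, co (basis_mon K i) = delta_mx 0 i,
      forall e q i, q \is e.-homog -> co q 0 i != 0 -> (bdeg i <= e)%N &
      forall e q, q \is e.-homog -> gs_ideal g1 g2
        (q - \sum_i co q 0 i *: ('X_v2 ^+ (e - bdeg i) * basis_mon K i))].

(** The first clause ties [co] to [Psi], for the comparison with determinants in [num_coordE]; the
    quotient algebra is developed from [is_coord] alone. *)
Lemma exists_coord (K : fieldType) (m : nat) (g1 g2 : {mpoly K[3]}) :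
  (0 < m)%N -> g1 \is m.-homog -> g2 \is m.-homog ->
  (forall h, in_Psi m g1 g2 h) ->
  exists co : {linear {mpoly K[3]} -> 'rV[K]_#|{: 'I_m * 'I_m}|},
    (forall h, exists2 h', Psi m g1 g2 h' = h & co h = cof m h') /\ is_coord g1 g2 co.
Proof.
move=> m0 hg1 hg2 sj; exists (Psi_coord sj); split.
  by move=> h; exists (Psi_inv sj h) => //; apply: Psi_invK.
split.
- exact: Psi_coord_z.
- exact: Psi_coord_ideal.
- exact: Psi_coord_basis.
- by move=> e q i; apply: Psi_coord_deg.
- by move=> e q; apply: Psi_coord_rep.
Unshelve. all: by [].
Qed.

(* An existential statement, so that [mult] is not unfolded by unification. *)
Lemma exists_mult (K : fieldType) (m : nat) (co : {mpoly K[3]} -> 'rV[K]_#|{: 'I_m * 'I_m}|) :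
  exists mult : {mpoly K[3]} -> 'M[K]_#|{: 'I_m * 'I_m}|,
    forall i h, row i (mult h) = co (h * basis_mon K i).
Proof. by exists (fun h => \matrix_i co (h * basis_mon K i)) => i h; rewrite rowK. Qed.

Section QuotientAlgebra.
Variables (K : fieldType) (m : nat) (g1 g2 : {mpoly K[3]}).
Hypothesis m_gt0 : (0 < m)%N.
Hypotheses (g1_homog : g1 \is m.-homog) (g2_homog : g2 \is m.-homog).
Local Notation D := #|{: 'I_m * 'I_m}|.
Local Notation gs_ideal := (gs_ideal g1 g2).
Local Notation basis_mon := (@basis_mon K m).
Implicit Types (a b : 'X_{1..3}) (h q : {mpoly K[3]}).
Variable qcoord : {linear {mpoly K[3]} -> 'rV[K]_D}.
Hypothesis qcoordP : is_coord g1 g2 qcoord.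
Variable mult : {mpoly K[3]} -> 'M[K]_D.
Hypothesis row_mult : forall i h, row i (mult h) = qcoord (h * basis_mon i).

Lemma qcoord_z q : qcoord ('X_v2 * q) = qcoord q. Proof. by case: qcoordP. Qed.

Lemma qcoord_zX k q : qcoord ('X_v2 ^+ k * q) = qcoord q.
Proof. by elim: k q => [|k IH] q; rewrite ?mul1r // exprSr -mulrA IH qcoord_z. Qed.

Lemma qcoord_ideal q : gs_ideal q -> qcoord q = 0. Proof. by move: q; case: qcoordP. Qed.

Lemma qcoord_basis i : qcoord (basis_mon i) = delta_mx 0 i. Proof. by case: qcoordP. Qed.

Lemma qcoord_deg e q i : q \is e.-homog -> qcoord q 0 i != 0 -> (bdeg i <= e)%N.
Proof. by case: qcoordP => _ _ _ h _; apply: h. Qed.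

Lemma qcoord_rep e q : q \is e.-homog ->
  gs_ideal (q - \sum_i qcoord q 0 i *: ('X_v2 ^+ (e - bdeg i) * basis_mon i)).
Proof. by case: qcoordP => _ _ _ _ h; apply: h. Qed.

Lemma qcoord_eq0 e q : q \is e.-homog -> qcoord q = 0 -> gs_ideal q.
Proof.
move=> hq q0; have := qcoord_rep hq; rewrite big1 ?subr0 // => i _.
by rewrite q0 mxE scale0r.
Qed.

Lemma gs_ideal_pihomog e q : gs_ideal q -> gs_ideal (pihomog mdeg e q).
Proof. by apply: ideal_gen_pihomog => g [->|->]; exists m. Qed.

Lemma zX_homog k : ('X_v2 ^+ k : {mpoly K[3]}) \is k.-homog.
Proof. by rewrite -{2}(mul1n k); apply: dhomogMn; rewrite dhomogX /= mdeg1. Qed.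

(** z is a nonzerodivisor modulo (g1, g2): the coordinates do not see z, and in a fixed degree they
    determine the class. *)
Lemma gs_ideal_zX k q : gs_ideal ('X_v2 ^+ k * q) -> gs_ideal q.
Proof.
move=> hq; rewrite (pihomog_partitionE (mf := mdeg) (leqnn (msize q))).
apply: ideal_gen_sum => e _; apply: (@qcoord_eq0 e); first exact: pihomogP.
rewrite -(qcoord_zX k) mulrC -[X in pihomog _ X](addnK k e).
have := pihomogM (e + k) q (zX_homog k); rewrite leq_addl => <-.
by apply/qcoord_ideal/gs_ideal_pihomog; rewrite mulrC.
Qed.

Lemma qcoordM h q : qcoord (h * q) = qcoord q *m mult h.
Proof.
elim/mpoly_lin_ind: q => [|p p' IHp IHq|c p IH|a].
- by rewrite mulr0 linear0 mul0mx.
- by rewrite mulrDr !linearD /= mulmxDl IHp IHq.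
- by rewrite -scalerAr !linearZ /= -scalemxAl IH.
have ha : ('X_[a] : {mpoly K[3]}) \is (mdeg a).-homog by rewrite dhomogX.
have /(ideal_genM h)/qcoord_ideal := qcoord_rep ha.
rewrite mulrBr linearB /= => /eqP; rewrite subr_eq0 => /eqP ->.
rewrite mulr_sumr linear_sum mulmx_sum_row; apply: eq_bigr => i _.
by rewrite -scalerAr linearZ /= mulrCA qcoord_zX row_mult.
Qed.

Lemma basis_mon0 : exists i, basis_mon i = 1.
Proof.
exists (enum_rank (Ordinal m_gt0, Ordinal m_gt0)).
rewrite /basis_mon /bexp enum_rankK /= (_ : mnm3 0 0 0 = 0%MM) ?mpolyX0 //.
by apply: mnm3P; rewrite mnm3E mnm0E.
Qed.

Lemma multC c : mult c%:MP = c%:M.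
Proof.
apply/row_matrixP => i; rewrite row_mult mul_mpolyC linearZ /= qcoord_basis.
by apply/rowP => j; rewrite !mxE eqxx /= eq_sym mulr_natr.
Qed.

Lemma multD h h' : mult (h + h') = mult h + mult h'.
Proof. by apply/row_matrixP => i; rewrite [RHS]linearD /= !row_mult mulrDl linearD. Qed.

Lemma multM h h' : mult (h * h') = mult h' *m mult h.
Proof. by apply/row_matrixP => i; rewrite row_mul !row_mult -mulrA qcoordM. Qed.

Lemma mult_comm h h' : mult h' *m mult h = mult h *m mult h'.
Proof. by rewrite -(multM h h') -(multM h' h) mulrC. Qed.

Lemma mult_z : mult 'X_v2 = 1%:M.
Proof. by apply/row_matrixP => i; rewrite row_mult qcoord_z qcoord_basis row1. Qed.

Lemma mult_ideal h : gs_ideal h -> mult h = 0.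
Proof.
move=> hh; apply/row_matrixP => i; rewrite row_mult row0 mulrC.
exact/qcoord_ideal/ideal_genM.
Qed.

End QuotientAlgebra.

(** * Diagonalization *)

(* [horner_mx] for matrices of arbitrary size, truncated at degree [N]. *)
Definition matrix_poly (R : comNzRingType) (n N : nat) (A : 'M[R]_n) (p : {poly R}) : 'M[R]_n :=
  \sum_(k < N) p`_k *: iter k (mulmx A) 1%:M.

Lemma map_matrix_poly (R R' : comNzRingType) (g : {rmorphism R -> R'}) (n N : nat)
    (A : 'M[R]_n) (p : {poly R}) :
  map_mx g (matrix_poly N A p) = matrix_poly N (map_mx g A) (map_poly g p).
Proof.
rewrite /matrix_poly map_mx_sum; apply: eq_bigr => k _.
rewrite map_mxZ coef_map; congr (_ *: _).
by elim: (k : nat) => [|l IH]; rewrite ?map_mx1 //= map_mxM IH.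
Qed.

Section Diagonalization.
Variables (K : fieldType) (n : nat).
Implicit Types (A B P : 'M[K]_n) (d : 'rV[K]_n).

Lemma matrix_poly_eigen N l A (V : 'M[K]_(l, n)) (L : 'M[K]_l) (p : {poly K}) :
  V *m A = L *m V -> V *m matrix_poly N A p = matrix_poly N L p *m V.
Proof.
move=> h; rewrite /matrix_poly mulmx_sumr mulmx_suml; apply: eq_bigr => k _.
rewrite -scalemxAr -scalemxAl; congr (_ *: _).
by elim: (k : nat) => [|j IH]; rewrite ?mulmx1 ?mul1mx //= mulmxA h -!mulmxA IH.
Qed.

Lemma matrix_poly_diag N d (p : {poly K}) : (size p <= N)%N ->
  matrix_poly N (diag_mx d) p = diag_mx (\row_i p.[d 0 i]).
Proof.
move=> sp; apply/matrixP => i j; rewrite /matrix_poly summxE !mxE.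
have pow k : iter k (mulmx (diag_mx d)) 1%:M i j = (d 0 i) ^+ k *+ (i == j).
  elim: k => [|k IH] /=; first by rewrite mxE.
  by rewrite mul_diag_mx mxE IH exprS mulrnAr.
under eq_bigr do rewrite mxE pow mulrnAr.
by rewrite sumrMnl (horner_coef_wide _ sp).
Qed.

(** In a dependence relation u between the rows, the polynomial in A whose roots are all eigenvalues
    but the i-th kills every row except the i-th, hence u_i = 0. *)
Lemma eigenrows_unit A P d : P *m A = diag_mx d *m P -> injective (d 0) ->
  (forall i, row i P != 0) -> P \in unitmx.
Proof.
move=> PA dinj Pn0; rewrite unitmxE unitfE; apply/negP => /det0P [u u0 uP].
have [i ui] : exists i, u 0 i != 0.
  apply/existsP; apply: contraR u0; rewrite negb_exists => /forallP h.
  by apply/eqP/rowP => i; rewrite mxE; apply/eqP; move: (h i); rewrite negbK.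
pose q := \prod_(j in predC1 i) ('X - (d 0 j)%:P).
have sq : (size q <= n)%N.
  rewrite /q -big_enum size_prod_XsubC -cardE cardC1 card_ord prednK //.
  exact: leq_ltn_trans (leq0n _) (ltn_ord i).
have := congr1 (mulmx^~ (matrix_poly n A q)) uP; rewrite mul0mx -mulmxA.
rewrite (matrix_poly_eigen _ _ PA) matrix_poly_diag // mulmxA mulmx_sum_row.
rewrite (bigD1 i) //= big1 => [|j ne]; last first.
  rewrite mul_mx_diag !mxE /q horner_prod (bigD1 j) //= hornerXsubC subrr mul0r mulr0.
  by rewrite scale0r.
rewrite addr0 mul_mx_diag !mxE => /eqP; rewrite scalemx_eq0 (negPf (Pn0 i)) orbF.
rewrite mulf_eq0 (negPf ui) /q horner_prod => /prodf_eq0 [j ne].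
by rewrite hornerXsubC subr_eq0 => /eqP /dinj e; rewrite e inE eqxx in ne.
Qed.

Lemma commute_diag A B P d : P \in unitmx -> P *m A = diag_mx d *m P -> injective (d 0) ->
  A *m B = B *m A -> exists b, P *m B = diag_mx b *m P.
Proof.
move=> Pu PA dinj AB; pose B' := P *m B *m invmx P.
have cB : B' *m diag_mx d = diag_mx d *m B'.
  have -> : diag_mx d = P *m A *m invmx P by rewrite PA mulmxK.
  by rewrite /B' !mulmxA mulmxKV // mulmxKV // -(mulmxA P B A) -AB mulmxA.
exists (\row_i B' i i).
suff -> : diag_mx (\row_i B' i i) = B' by rewrite /B' mulmxKV.
apply/matrixP => i j; rewrite !mxE; have [->|ne] := eqVneq i j; first by rewrite mulr1n.
rewrite mulr0n; move/matrixP/(_ i j): cB; rewrite mul_mx_diag mul_diag_mx !mxE => /eqP.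
rewrite mulrC -subr_eq0 -mulrBl mulf_eq0 subr_eq0 => /orP[/eqP /dinj e|/eqP -> //].
by rewrite e eqxx in ne.
Qed.

(** For p the characteristic polynomial, the determinant of p'(A) is up to sign the discriminant of
    p. On the eigenbasis p'(A) is diagonal, and its entries are the values of p' at simple roots of
    p. *)
Lemma disc_of_diag A P d : P \in unitmx -> P *m A = diag_mx d *m P -> injective (d 0) ->
  matrix_poly n A (char_poly A)^`() \in unitmx.
Proof.
move=> Pu PA dinj; set p := char_poly A.
have dr i : root p (d 0 i).
  rewrite -eigenvalue_root_char; apply/eigenvalueP; exists (row i P).
    by rewrite -row_mul PA row_mul row_diag_mx -scalemxAl -rowE.
  apply/eqP => e; have := Pu; rewrite -row_free_unit => /row_freeP [Q PQ].
  have := congr1 (row i) PQ; rewrite row_mul e mul0mx => /rowP/(_ i)/eqP.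
  by rewrite !mxE eqxx eq_sym oner_eq0.
pose rs := [seq d 0 i | i : 'I_n].
have urs : uniq rs by rewrite map_inj_uniq ?enum_uniq.
have def_p : p = \prod_(z <- rs) ('X - z%:P).
  rewrite [LHS](all_roots_prod_XsubC (rs := rs)) ?uniq_rootsE //.
  - by rewrite (monicP (char_poly_monic A)) scale1r.
  - by rewrite size_char_poly size_map size_enum_ord.
  - by apply/allP => z /mapP [i _ ->].
have sepp : separable_poly p by rewrite def_p separable_prod_XsubC.
have p'r i : p^`().[d 0 i] != 0.
  move: sepp; rewrite unlock => /coprimep_root; apply; exact: dr.
have sp : (size p^`() <= n)%N.
  by rewrite -ltnS -(size_char_poly A); apply: lt_size_deriv; rewrite monic_neq0 ?char_poly_monic.
have := matrix_poly_eigen n p^`() PA; rewrite matrix_poly_diag //.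
move=> /(congr1 determinant); rewrite !det_mulmx mulrC => /mulIf e.
rewrite unitmxE e; last by rewrite -unitfE -unitmxE.
rewrite det_diag unitfE; apply/prodf_neq0 => i _; by rewrite mxE.
Qed.

End Diagonalization.

(** If z were a multiple root of p, an eigenvector v for z would satisfy v p'(A) = p'(z) v = 0,
    against invertibility. So there are n distinct eigenvalues. *)
Lemma diag_of_disc (K : closedFieldType) (n : nat) (A : 'M[K]_n) :
  matrix_poly n A (char_poly A)^`() \in unitmx ->
  exists P d, [/\ P \in unitmx, P *m A = diag_mx d *m P & injective (d 0)].
Proof.
move=> hu; set p := char_poly A; have [rs def_p] := closed_field_poly_normal p.
have mp : p \is monic by apply: char_poly_monic.
rewrite (monicP mp) scale1r in def_p.
have srs : size rs = n by have := size_char_poly A; rewrite -/p def_p size_prod_XsubC => -[].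
have eig z : z \in rs -> exists2 v : 'rV_n, v *m A = z *: v & v != 0.
  move=> zr; apply/eigenvalueP; rewrite eigenvalue_root_char -/p def_p.
  by rewrite root_prod_XsubC.
have sp : (size p^`() <= n)%N.
  by rewrite -ltnS -(size_char_poly A); apply: lt_size_deriv; rewrite monic_neq0.
have urs : uniq rs.
  rewrite -separable_prod_XsubC -def_p unlock; apply/negPn/negP.
  rewrite /coprimep => /closed_rootP [z].
  rewrite root_gcd => /andP[zp /eqP zp'].
  have /eig [v vA] : z \in rs by rewrite -root_prod_XsubC -def_p.
  case/eqP; rewrite -(mul_scalar_mx) in vA.
  have := matrix_poly_eigen n p^`() vA.
  rewrite -diag_const_mx matrix_poly_diag // => e.
  rewrite -[v](mulmxK hu) e (_ : (\row_i _) = 0) ?linear0 ?mul0mx //.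
  by apply/rowP => i; rewrite !mxE.
have [v vA v0] := fin_all_exists2 (fun i : 'I_n => eig (tnth (Tuple (introT eqP srs)) i) (mem_tnth i _)).
pose d : 'rV[K]_n := \row_i tnth (Tuple (introT eqP srs)) i.
pose P := \matrix_i v i.
have PA : P *m A = diag_mx d *m P.
  by apply/row_matrixP => i; rewrite !row_mul row_diag_mx -scalemxAl -rowE rowK vA mxE.
have dinj : injective (d 0).
  move=> i j; rewrite !mxE !(tnth_nth 0) /= => /eqP.
  by rewrite nth_uniq ?srs // => /eqP/val_inj.
exists P, d; split=> //; apply: (eigenrows_unit PA dinj) => i; by rewrite rowK.
Qed.

(** * Residues *)

Lemma pred_ltn (m : nat) : (0 < m)%N -> (m.-1 < m)%N. Proof. by case: m. Qed.

Definition top_idx (m : nat) (m_gt0 : (0 < m)%N) : 'I_#|{: 'I_m * 'I_m}| :=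
  enum_rank (Ordinal (pred_ltn m_gt0), Ordinal (pred_ltn m_gt0)).

(** The complement of [basis_mon i] in x^(m-1) y^(m-1), hence its candidate dual under the residue
    pairing. *)
Definition rev_mon (R : comNzRingType) (m : nat) (i : 'I_#|{: 'I_m * 'I_m}|) : {mpoly R[3]} :=
  'X_[mnm3 (m.-1 - (bexp i).1) (m.-1 - (bexp i).2) 0].

Lemma bexp_top m (m_gt0 : (0 < m)%N) :
  ((bexp (top_idx m_gt0)).1 = m.-1 :> nat) * ((bexp (top_idx m_gt0)).2 = m.-1 :> nat).
Proof. by rewrite /bexp enum_rankK. Qed.

Lemma bdeg_top m (m_gt0 : (0 < m)%N) : bdeg (top_idx m_gt0) = m.-1.*2.
Proof. by rewrite /bdeg !bexp_top addnn. Qed.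

Lemma bdeg_le m (i : 'I_#|{: 'I_m * 'I_m}|) : (bdeg i <= m.-1.*2)%N.
Proof.
rewrite /bdeg -addnn; have := ltn_ord (bexp i).1; have := ltn_ord (bexp i).2.
by case: {i}m i => // m' i; lia.
Qed.

Lemma rev_mon_homog (K : fieldType) m (i : 'I_#|{: 'I_m * 'I_m}|) :
  rev_mon K i \is (m.-1.*2 - bdeg i).-homog.
Proof.
rewrite dhomogX /= mdeg_mnm3 /bdeg; apply/eqP.
have := ltn_ord (bexp i).1; have := ltn_ord (bexp i).2.
by case: {i}m i => // m' i; lia.
Qed.

Section Duality.
Variables (K : fieldType) (m : nat) (g1 g2 : {mpoly K[3]}).
Hypothesis m_gt0 : (0 < m)%N.
Hypotheses (g1_homog : g1 \is m.-homog) (g2_homog : g2 \is m.-homog).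
Local Notation D := #|{: 'I_m * 'I_m}|.
Local Notation gs_ideal := (gs_ideal g1 g2).
Local Notation basis_mon := (@basis_mon K m).
Local Notation rev_mon := (@rev_mon K m).
Implicit Types (a b : 'X_{1..3}) (h q : {mpoly K[3]}).
Variable qcoord : {linear {mpoly K[3]} -> 'rV[K]_D}.
Hypothesis qcoordP : is_coord g1 g2 qcoord.
Variable mult : {mpoly K[3]} -> 'M[K]_D.
Hypothesis row_mult : forall i h, row i (mult h) = qcoord (h * basis_mon i).

Definition resid q : K := qcoord q 0 (top_idx m_gt0).

Lemma residD p q : resid (p + q) = resid p + resid q.
Proof. by rewrite /resid linearD mxE. Qed.

Lemma residZ c q : resid (c *: q) = c * resid q.
Proof. by rewrite /resid linearZ mxE. Qed.

Lemma resid_low e q : q \is e.-homog -> (e < m.-1.*2)%N -> resid q = 0.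
Proof.
move=> hq lt; apply/eqP/negPn/negP => /(qcoord_deg qcoordP hq).
by rewrite bdeg_top leqNgt lt.
Qed.

Lemma resid_ideal q : gs_ideal q -> resid q = 0.
Proof. by move=> /(qcoord_ideal qcoordP) e; rewrite /resid e mxE. Qed.

Lemma resid_congr p q : gs_ideal (p - q) -> resid p = resid q.
Proof.
move=> /resid_ideal; rewrite residD -scaleN1r residZ mulN1r => /eqP.
by rewrite subr_eq0 => /eqP.
Qed.

Lemma resid_zX k q : resid ('X_v2 ^+ k * q) = resid q.
Proof. by rewrite /resid (qcoord_zX qcoordP). Qed.

(** The pairing of [rev_mon i] with [basis_mon j] vanishes for bdeg j < bdeg i by [resid_low], so
    its matrix is block triangular by degree; only the diagonal blocks are kept. Their entries are
    residues of forms of the single degree 2(m-1). *)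
Definition hankel : 'M[K]_D :=
  \matrix_(i, j) if bdeg i == bdeg j then resid (rev_mon i * basis_mon j) else 0.

Hypothesis hankel_unit : hankel \in unitmx.

(* Pairs the part of [q] of top degree in x, y with the monomials [rev_mon]:
   parts of lower degree do not contribute to the residue. *)
Lemma orthogonal_support e e' q : q \is e.-homog ->
  (forall q', q' \is e'.-homog -> resid (q * q') = 0) ->
  forall i, qcoord q 0 i != 0 -> (bdeg i + e' < m.-1.*2)%N.
Proof.
move=> hq orth i0 qi0; rewrite ltnNge; apply/negP => le0.
(* For i of maximal degree in the support of q, the coordinates of that degree form a vector in the
   kernel of [hankel]. The test forms are the [rev_mon a] of complementary degree, padded with a
   power of z to degree e'; there is room for this by [lei]. *)
case: (@arg_maxnP _ i0 (fun i => qcoord q 0 i != 0) (@bdeg m) qi0) => i qi imax.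
have lei : (m.-1.*2 <= bdeg i + e')%N by have := imax i0 qi0; rewrite /=; lia.
pose c : 'cV[K]_D := \col_b if bdeg b == bdeg i then qcoord q 0 b else 0.
have : hankel *m c = 0.
  apply/colP => a; rewrite !mxE; have [ea|ne] := eqVneq (bdeg a) (bdeg i); last first.
    apply: big1 => b _; rewrite !mxE; case: (eqVneq (bdeg b) (bdeg i)) => [->|]; last by rewrite mulr0.
    by rewrite (negPf ne) mul0r.
  pose k := (e' - (m.-1.*2 - bdeg i))%N.
  have hq' : 'X_v2 ^+ k * rev_mon a \is e'.-homog.
    have -> : e' = (1 * k + (m.-1.*2 - bdeg a))%N by rewrite /k ea; have := bdeg_le i; lia.
    apply: dhomogM; last exact: rev_mon_homog.
    by apply: dhomogMn; rewrite dhomogX /= mdeg1.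
  have := orth _ hq'; rewrite mulrCA resid_zX mulrC /resid (qcoordM qcoordP row_mult) mxE => h0; rewrite -[RHS]h0.
  apply: eq_bigr => b _; rewrite !mxE mulrC ea.
  have -> : mult (rev_mon a) b (top_idx m_gt0) = resid (rev_mon a * basis_mon b).
    by rewrite /resid -row_mult mxE.
  rewrite (eq_sym (bdeg i)); case: (ltngtP (bdeg b) (bdeg i)) => [lt|gt|_] //=; last first.
    have [->|nz] := eqVneq (qcoord q 0 b) 0; first by rewrite !mul0r.
    by have := imax b nz; rewrite /= leqNgt gt.
  rewrite (resid_low (dhomogM (rev_mon_homog K a) (basis_mon_homog K b))) ?mulr0 ?mul0r //.
  by rewrite ea; have := bdeg_le i; lia.
move=> /(congr1 (mulmx (invmx hankel))); rewrite mulKmx // mulmx0 => /colP/(_ i)/eqP.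
by rewrite !mxE eqxx (negPf qi).
Qed.

(** By [orthogonal_support] only basis monomials of degree at most 2m-3-e' occur in q, and each
    comes with a power of z of exponent at least e - (2m-3-e') = t. *)
Lemma orthogonal_divisible e e' t q : q \is e.-homog ->
  (forall q', q' \is e'.-homog -> resid (q * q') = 0) ->
  (t + m.*2 = e + e' + 3)%N ->
  exists q', gs_ideal (q - 'X_v2 ^+ t * q').
Proof.
move=> hq orth et; have sup := orthogonal_support hq orth.
exists (\sum_i qcoord q 0 i *: ('X_v2 ^+ (e - bdeg i - t) * basis_mon i)).
have := qcoord_rep qcoordP hq; congr (gs_ideal (_ - _)).
rewrite mulr_sumr; apply: eq_bigr => i _.
have [->|nz] := eqVneq (qcoord q 0 i) 0; first by rewrite !scale0r mulr0.
rewrite -scalerAr mulrA -exprD subnKC //.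
have := sup i nz; have := m_gt0; rewrite -!addnn in et *; lia.
Qed.

(** Invert f in the algebra where z = 1, then homogenise the inverse to degree 2(m-1), the largest
    degree of a basis monomial. *)
Lemma quotient_inverse c f : f \is c.-homog -> mult f \in unitmx ->
  exists2 f', f' \is (m.-1.*2).-homog & gs_ideal (f * f' - 'X_v2 ^+ (m.-1.*2 + c)).
Proof.
move=> hf fu; pose r := qcoord 1 *m invmx (mult f).
pose f' := \sum_i r 0 i *: ('X_v2 ^+ (m.-1.*2 - bdeg i) * basis_mon i).
have hz := @zX_homog K.
have hf' : f' \is (m.-1.*2).-homog.
  apply: rpred_sum => i _; apply: rpredZ.
  have := dhomogM (hz (m.-1.*2 - bdeg i)%N) (basis_mon_homog K i).
  by rewrite subnK ?bdeg_le.
exists f' => //; apply: (qcoord_eq0 qcoordP (e := (m.-1.*2 + c)%N)).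
  by apply: rpredB; [rewrite addnC; apply: dhomogM | apply: hz].
have cf' : qcoord f' = r.
  rewrite linear_sum [RHS]row_sum_delta; apply: eq_bigr => i _.
  by rewrite linearZ /= (qcoord_zX qcoordP) (qcoord_basis qcoordP).
rewrite linearB /= (qcoordM qcoordP row_mult) cf' /r mulmxKV //.
by rewrite -['X_v2 ^+ _]mulr1 (qcoord_zX qcoordP) subrr.
Qed.

Section Curve.
Variable f : {mpoly K[3]}.
Hypotheses (f_homog : f \is (m.*2 + 3).-homog) (f_unit : mult f \in unitmx).

Definition fgs_ideal : {mpoly K[3]} -> Prop :=
  ideal_gen (fun Q => [\/ Q = f, Q = g1 | Q = g2]).

Lemma gs_sub_fgs q : gs_ideal q -> fgs_ideal q.
Proof.
elim/ideal_gen_ind => [|p p' hp hp'|a g gg]; first exact: ideal_gen0.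
  exact: ideal_genD.
apply/ideal_genM/ideal_genP; case: gg; [by constructor 2|by constructor 3].
Qed.

(* The witness is an inverse of [f] modulo (g1, g2, z - 1). *)
Lemma macaulay_functional :
  exists f', [/\ forall q, q \is (4 * m).-homog -> fgs_ideal q -> resid (f' * q) = 0,
    forall d h, (d <= 4)%N -> h \is (d * m).-homog ->
      (forall h', h' \is ((4 - d) * m).-homog -> resid (f' * (h * h')) = 0) -> fgs_ideal h &
    forall h, h \is (5 * m).-homog -> fgs_ideal h].
Proof.
have [f' hf' ff'] := quotient_inverse f_homog f_unit.
set E := (m.-1.*2 + (m.*2 + 3))%N in ff'.
have defE : E = (4 * m).+1 by rewrite /E; have := m_gt0; rewrite -!addnn; lia.
(* Multiplying by f replaces f' f by z^E, so z^E (h - q f) lies in (g1, g2), and z^E cancels. *)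
have cancelf h q : gs_ideal (f' * h - 'X_v2 ^+ E * q) -> fgs_ideal h.
  move=> hq; have : gs_ideal (h - q * f).
    apply: (gs_ideal_zX g1_homog g2_homog qcoordP (k := E)).
    have -> : 'X_v2 ^+ E * (h - q * f) =
      f * (f' * h - 'X_v2 ^+ E * q) - h * (f * f' - 'X_v2 ^+ E) by ring.
    by apply: ideal_genB; apply: ideal_genM.
  move=> /gs_sub_fgs hfq; rewrite -[h](subrK (q * f)); apply: ideal_genD => //.
  by apply/ideal_genM/ideal_genP; constructor 1.
exists f'; split.
- move=> q hq hI; rewrite -(pihomog_dE hq).
  elim/ideal_gen_ind: hI => [|p p' hp hp'|a g gg].
  + by rewrite linear0 mulr0 /resid linear0 mxE.
  + by rewrite linearD mulrDr residD hp hp' addr0.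
  have gsg g' : g' = g1 \/ g' = g2 -> resid (f' * pihomog mdeg (4 * m) (a * g')) = 0.
    move=> hg; apply: resid_ideal; apply: ideal_genM; apply: (gs_ideal_pihomog g1_homog g2_homog).
    by apply: ideal_genM; apply: ideal_genP.
  case: gg => [->|->|->]; [|by apply: gsg; left|by apply: gsg; right].
  rewrite (pihomogM _ _ f_homog); case: ifP => le; last by rewrite mulr0 /resid linear0 mxE.
  set a' := pihomog _ _ a; have ha' : a' \is (4 * m - (m.*2 + 3)).-homog by apply: pihomogP.
  rewrite -[RHS](resid_low ha'); last by have := m_gt0; rewrite -!addnn in le *; lia.
  rewrite -[RHS](resid_zX E); apply: resid_congr.
  have -> : f' * (a' * f) - 'X_v2 ^+ E * a' = a' * (f * f' - 'X_v2 ^+ E) by ring.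
  exact: ideal_genM.
- move=> d h d4 hh orth.
  have [|q hq] := @orthogonal_divisible _ ((4 - d) * m) E _ (dhomogM hf' hh)
    (fun q' hq' => etrans (congr1 resid (esym (mulrA f' h q'))) (orth q' hq')).
    rewrite defE; have : (d * m + (4 - d) * m = 4 * m)%N by rewrite -mulnDl subnKC.
    by have := m_gt0; rewrite -!addnn; lia.
  exact: cancelf hq.
(* Here f' h has degree 2(m-1) + 5m and basis monomials have degree at most 2(m-1), so every term
   carries at least z^(5m), and 5m >= 4m+1 = E. *)
move=> h hh; have := qcoord_rep qcoordP (dhomogM hf' hh) => hq.
apply: (cancelf _ (\sum_i qcoord (f' * h) 0 i *:
  ('X_v2 ^+ (m.-1.*2 + 5 * m - bdeg i - E) * basis_mon i))).
move: hq; congr (gs_ideal (_ - _)); rewrite mulr_sumr; apply: eq_bigr => i _.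
rewrite -scalerAr mulrA -exprD subnKC // defE.
by have := bdeg_le i; have := m_gt0; lia.
Qed.

End Curve.

(** All multiplications commute with A, whose eigenvalues are distinct, so they are diagonal in its
    eigenbasis. The eigenvalues of x and y, together with z = 1, are the coordinates of D points, on
    which g1 and g2 vanish because they act by zero. The factor c allows A to be a matrix with
    cleared denominators. *)
Lemma resid_points (P A : 'M[K]_D) (d : 'rV[K]_D) (l : {mpoly K[3]}) c :
  A = c *: mult l -> P \in unitmx -> P *m A = diag_mx d *m P -> injective (d 0) -> c != 0 ->
  exists (u : 'I_D -> K) (x : 'I_D -> 'I_3 -> K),
    [/\ forall h, resid h = \sum_i u i * h.@[x i],
        forall i, g1.@[x i] = 0, forall i, g2.@[x i] = 0 & forall i, x i v2 = 1].
Proof.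
move=> def_A Pu PA dinj c0.
have comm h : A *m mult h = mult h *m A.
  by rewrite def_A -scalemxAl -scalemxAr (mult_comm qcoordP row_mult).
have [X PX] := commute_diag Pu PA dinj (comm 'X_v0).
have [Y PY] := commute_diag Pu PA dinj (comm 'X_v1).
pose x i (j : 'I_3) := nth 1 [:: X 0 i; Y 0 i] j.
have Pm h : P *m mult h = diag_mx (\row_i h.@[x i]) *m P.
  elim/mpoly_ring_ind: h => [k|j|p q IHp IHq|p q IHp IHq].
  - rewrite (multC qcoordP row_mult) mul_mx_scalar -mul_scalar_mx -diag_const_mx.
    by congr (diag_mx _ *m _); apply/rowP => i; rewrite !mxE mevalC.
  - elim/ord3P: j.
    + by rewrite PX; congr (diag_mx _ *m _); apply/rowP => i; rewrite !mxE mevalXU.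
    + by rewrite PY; congr (diag_mx _ *m _); apply/rowP => i; rewrite !mxE mevalXU.
    rewrite (mult_z qcoordP row_mult) mulmx1 -[LHS]mul1mx -diag_const_mx.
    by congr (diag_mx _ *m _); apply/rowP => i; rewrite !mxE mevalXU.
  - rewrite (multD row_mult) mulmxDr IHp IHq -mulmxDl -linearD /=.
    by congr (diag_mx _ *m _); apply/rowP => i; rewrite !mxE mevalD.
  rewrite (multM qcoordP row_mult) mulmxA IHq -mulmxA IHp mulmxA mulmx_diag.
  by congr (diag_mx _ *m _); apply/rowP => i; rewrite !mxE mevalM mulrC.
have gz g : gs_ideal g -> forall i, g.@[x i] = 0.
  move=> /(mult_ideal qcoordP row_mult) g0 i; have := Pm g; rewrite g0 mulmx0.
  move=> /(congr1 (mulmx^~ (invmx P))); rewrite mul0mx mulmxK //.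
  by move=> /matrixP/(_ i i); rewrite !mxE eqxx mulr1n.
exists (fun i => (qcoord 1 *m invmx P) 0 i * P i (top_idx m_gt0)), x; split=> //.
- move=> h; rewrite /resid -[h in LHS]mulr1 (qcoordM qcoordP row_mult).
  rewrite -[mult h](mulKmx Pu) Pm !mulmxA mxE; apply: eq_bigr => i _.
  by rewrite mul_mx_diag !mxE; ring.
- by apply/gz/ideal_genP; left.
- by apply/gz/ideal_genP; right.
Qed.

End Duality.

(** * Determinants with generic coefficients *)

(* The matrices of the quotient algebra multiplied by the determinant of
   [psi_mx_gen], so that their entries are polynomial in the coefficients of
   [g1] and [g2]. *)
Section GenericMatrices.
Variables (R : comNzRingType) (m : nat) (m_gt0 : (0 < m)%N) (g1 g2 : {mpoly R[3]}).
Local Notation D := #|{: 'I_m * 'I_m}|.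

Definition basis_sel (e : nat) : 'M[R]_(size (ternary_monomials e), D) :=
  \matrix_(i, j) ((mon_at i v0 == (bexp j).1) && (mon_at i v1 == (bexp j).2))%:R.

Definition num_coord (e : nat) (h : {mpoly R[3]}) : 'rV[R]_D :=
  crd e h *m \adj (psi_mx_gen m g1 g2 e) *m basis_sel e.

(** The powers of z bring all rows to one degree, so that the same determinant factor appears in
    each of them; see [num_multE]. *)
Definition num_mult (c : nat) (h : {mpoly R[3]}) : 'M[R]_D :=
  \matrix_i num_coord (m.-1.*2 + c) ('X_v2 ^+ (m.-1.*2 - bdeg i) * (h * basis_mon R i)).

Definition num_hankel : 'M[R]_D :=
  \matrix_(i, j) if bdeg i == bdeg j
    then num_coord m.-1.*2 (rev_mon R i * basis_mon R j) 0 (top_idx m_gt0) else 0.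

Definition sep_form : {mpoly R[3]} := 'X_v0 + m%:R *: 'X_v1.

(* Nonzero only if the multiplication by [sep_form] has distinct eigenvalues;
   [sep_form] separates the vertices of an m x m grid with unit steps. *)
Definition num_disc : R :=
  \det (matrix_poly D (num_mult 1 sep_form) (char_poly (num_mult 1 sep_form))^`()).

(** Nonvanishing of the factors gives, in order: freeness over K[z], perfect duality, a reduced
    algebra at z = 1, and invertibility of f in it. *)
Definition general_det (f : {mpoly R[3]}) : R :=
  (\prod_(e < m.*2) \det (psi_mx_gen m g1 g2 e)) * \det num_hankel * num_disc *
  \det (num_mult (m.*2 + 3) f).

End GenericMatrices.

Section Naturality.
Variables (R R' : comNzRingType) (phi : {rmorphism R -> R'}) (m : nat) (m_gt0 : (0 < m)%N).
Variables (g1 g2 : {mpoly R[3]}).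
Local Notation g1' := (map_mpoly phi g1).
Local Notation g2' := (map_mpoly phi g2).

Lemma map_crd e h : map_mx phi (crd e h) = crd e (map_mpoly phi h).
Proof. by apply/rowP => i; rewrite !mxE mcoeff_map_mpoly. Qed.

Lemma map_psi_gen a : map_mpoly phi (psi_gen m g1 g2 a) = psi_gen m g1' g2' a.
Proof. by rewrite /psi_gen !rmorphM !rmorphXn /= map_mpolyX. Qed.

Lemma map_psi_mx_gen e : map_mx phi (psi_mx_gen m g1 g2 e) = psi_mx_gen m g1' g2' e.
Proof. by apply/row_matrixP => i; rewrite -map_row !rowK map_crd map_psi_gen. Qed.

Lemma map_num_coord e h :
  map_mx phi (num_coord m g1 g2 e h) = num_coord m g1' g2' e (map_mpoly phi h).
Proof.
have es : map_mx phi (basis_sel R m e) = basis_sel R' m e.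
  by apply/matrixP => i j; rewrite !mxE rmorph_nat.
by rewrite /num_coord !map_mxM map_crd map_mx_adj map_psi_mx_gen es.
Qed.

Lemma map_num_mult c h :
  map_mx phi (num_mult m g1 g2 c h) = num_mult m g1' g2' c (map_mpoly phi h).
Proof.
apply/row_matrixP => i; rewrite -map_row !rowK map_num_coord !rmorphM rmorphXn /=.
by rewrite !map_mpolyX.
Qed.

(** Allows the determinant to be formed once for indeterminate coefficients and then specialised to
    any pair of forms. *)
Lemma map_general_det f :
  phi (general_det m_gt0 g1 g2 f) = general_det m_gt0 g1' g2' (map_mpoly phi f).
Proof.
have esep : map_mpoly phi (sep_form R m) = sep_form R' m.
  by rewrite /sep_form rmorphD /= !(map_mpolyX, map_mpolyZ) rmorph_nat.
rewrite /general_det /num_disc !rmorphM rmorph_prod -!det_map_mx map_num_mult.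
rewrite map_matrix_poly -deriv_map map_char_poly map_num_mult esep.
congr (_ * _ * _ * _).
  by apply: eq_bigr => e _; rewrite -det_map_mx map_psi_mx_gen.
congr (\det _); apply/matrixP => i j; rewrite [LHS]mxE [in LHS]mxE [RHS]mxE.
case: ifP => _; last by rewrite rmorph0.
have := map_num_coord m.-1.*2 (rev_mon R i * basis_mon R j).
by move=> /rowP/(_ (top_idx m_gt0)); rewrite [LHS]mxE => ->; rewrite rmorphM /= !map_mpolyX.
Qed.

End Naturality.

Section OverField.
Variables (K : fieldType) (m : nat) (g1 g2 : {mpoly K[3]}).
Hypothesis m_gt0 : (0 < m)%N.
Hypotheses (g1_homog : g1 \is m.-homog) (g2_homog : g2 \is m.-homog).
Hypothesis Psi_surj : forall h, in_Psi m g1 g2 h.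
Local Notation D := #|{: 'I_m * 'I_m}|.
Variable qcoord : {linear {mpoly K[3]} -> 'rV[K]_D}.
Hypothesis qcoord_Psi : forall h, exists2 h', Psi m g1 g2 h' = h & qcoord h = cof m h'.
Hypothesis qcoordP : is_coord g1 g2 qcoord.
Variable mult : {mpoly K[3]} -> 'M[K]_D.
Hypothesis row_mult : forall i h, row i (mult h) = qcoord (h * basis_mon K i).

Lemma psi_mx_unit e : psi_mx_gen m g1 g2 e \in unitmx.
Proof. by apply/psi_mx_unitP => // h _; apply: Psi_surj. Qed.

Local Notation det e := (\det (psi_mx_gen m g1 g2 e)).

Lemma psi_det_neq0 e : det e != 0.
Proof. by rewrite -unitfE -unitmxE psi_mx_unit. Qed.

Lemma cof_pol e (r : 'rV[K]_(size (ternary_monomials e))) :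
  cof m (pol r) = r *m basis_sel K m e.
Proof.
rewrite /pol linear_sum mulmx_sum_row; apply: eq_bigr => i _.
by rewrite linearZ; congr (_ *: _); apply/rowP => j; rewrite cofX !mxE.
Qed.

Lemma num_coordE e h : h \is e.-homog -> num_coord m g1 g2 e h = det e *: qcoord h.
Proof.
move=> hh; have [h' def_h ->] := qcoord_Psi h.
have -> : h' = pol (crd e h *m invmx (psi_mx_gen m g1 g2 e)).
  apply: (Psi_inj m_gt0 g1_homog g2_homog Psi_surj); rewrite def_h.
  rewrite -[RHS](@crdK _ e) ?Psi_homog ?pol_homog // crd_Psi ?pol_homog //.
  by rewrite polK mulmxKV ?psi_mx_unit // crdK.
have -> : num_coord m g1 g2 e h = crd e h *m
    (det e *: invmx (psi_mx_gen m g1 g2 e)) *m basis_sel K m e.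
  rewrite /invmx psi_mx_unit scalerA divff ?psi_det_neq0 // scale1r //.
by rewrite cof_pol -scalemxAr -scalemxAl.
Qed.

Lemma num_multE c h : h \is c.-homog ->
  num_mult m g1 g2 c h = det (m.-1.*2 + c) *: mult h.
Proof.
move=> hh; apply/row_matrixP => i; rewrite linearZ /= row_mult rowK.
rewrite num_coordE ?(qcoord_zX qcoordP) // -[X in (X + c)%N](subnK (bdeg_le i)).
rewrite -addnA [(bdeg i + c)%N]addnC; apply: dhomogM; first exact: zX_homog.
exact: dhomogM (basis_mon_homog _ _).
Qed.

Lemma num_hankelE : num_hankel m_gt0 g1 g2 = det m.-1.*2 *: hankel m_gt0 qcoord.
Proof.
apply/matrixP => i j; rewrite [LHS]mxE [RHS]mxE [in RHS]mxE.
case: eqP => [e|_]; last by rewrite mulr0.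
have hh : rev_mon K i * basis_mon K j \is (m.-1.*2).-homog.
  have := dhomogM (rev_mon_homog K i) (basis_mon_homog K j).
  by rewrite -e subnK ?bdeg_le.
by rewrite num_coordE // mxE.
Qed.

End OverField.

(** * Duality for general forms *)

Lemma sep_form_homog (K : fieldType) m : sep_form K m \is 1.-homog.
Proof. by rewrite /sep_form rpredD ?rpredZ // dhomogX /= mdeg1. Qed.

Lemma complete_intersection_duality (K : numClosedFieldType) (m : nat) (m_gt0 : (0 < m)%N)
    (g1 g2 f : {mpoly K[3]}) :
  g1 \is m.-homog -> g2 \is m.-homog -> f \is (m.*2 + 3).-homog ->
  general_det m_gt0 g1 g2 f != 0 ->
  exists (lam : 'I_#|{: 'I_m * 'I_m}| -> K) (x : 'I_#|{: 'I_m * 'I_m}| -> 'I_3 -> K),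
    let phi h := \sum_i lam i * h.@[x i] in
    [/\ forall q, q \is (4 * m).-homog -> fgs_ideal g1 g2 f q -> phi q = 0,
      forall d h, (d <= 4)%N -> h \is (d * m).-homog ->
        (forall h', h' \is ((4 - d) * m).-homog -> phi (h * h') = 0) -> fgs_ideal g1 g2 f h,
      forall h, h \is (5 * m).-homog -> fgs_ideal g1 g2 f h &
      forall i, g1.@[x i] = 0 /\ g2.@[x i] = 0].
Proof.
move=> hg1 hg2 hf; rewrite /general_det !mulf_eq0 !negb_or -!andbA => /and4P[].
move=> /prodf_neq0 low hank disc multf.
have sj : forall h, in_Psi m g1 g2 h.
  apply: Psi_surj_of_low => // e le.
  by rewrite unitmxE unitfE; apply: (low (Ordinal le)).
have [co [coPsi coP]] := exists_coord m_gt0 hg1 hg2 sj.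
have [mult row_mult] := exists_mult co.
have det0 := psi_det_neq0 m_gt0 hg1 hg2 sj.
have multE := num_multE m_gt0 hg1 hg2 sj coPsi coP row_mult.
have hu : hankel m_gt0 co \in unitmx.
  move: hank; rewrite (num_hankelE m_gt0 hg1 hg2 sj coPsi) detZ mulf_eq0 negb_or => /andP[_].
  by rewrite unitmxE unitfE.
have fu : mult f \in unitmx.
  move: multf; rewrite multE // detZ mulf_eq0 negb_or => /andP[_].
  by rewrite unitmxE unitfE.
have [P [d [Pu PA dinj]]] : exists P d,
    [/\ P \in unitmx, P *m num_mult m g1 g2 1 (sep_form K m) =
      diag_mx d *m P & injective (d 0)].
  by apply: diag_of_disc; rewrite unitmxE unitfE.
have [u [x [resE x1 x2 _]]] := resid_points m_gt0 coP row_mult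
  (multE _ _ (sep_form_homog K m)) Pu PA dinj (det0 _).
have [f' [h1 h2 h3]] := macaulay_functional (m_gt0 := m_gt0) hg1 hg2 coP row_mult hu hf fu.
(* The functional is h -> residue of f' h, so the weight of the residue at each point is multiplied
   by the value of f' there. *)
exists (fun i => u i * f'.@[x i]), x => /=.
have phiE h : \sum_i u i * f'.@[x i] * h.@[x i] = resid m_gt0 co (f' * h).
  by rewrite resE; apply: eq_bigr => i _; rewrite mevalM mulrA.
split=> //.
- by move=> q hq qI; rewrite phiE h1.
- by move=> e h e4 hh orth; apply: (h2 e) => // h' hh'; rewrite -phiE; apply: orth.
Qed.

(** * The special case of a grid of lines *)

Section Grid.
Variables (K : numFieldType) (m : nat) (m_gt0 : (0 < m)%N) (al be : K).
Local Notation D := #|{: 'I_m * 'I_m}|.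

Definition grid_form (i : 'I_3) (c : K) : {mpoly K[3]} :=
  \prod_(k < m) ('X_i - (c + k%:R) *: 'X_v2).

Local Notation g1 := (grid_form v0 al).
Local Notation g2 := (grid_form v1 be).

Lemma grid_form_homog i c : grid_form i c \is m.-homog.
Proof.
suff h n (F : 'I_n -> {mpoly K[3]}) : (forall k, F k \is 1.-homog) -> \prod_k F k \is n.-homog.
  by apply: h => k; rewrite rpredB ?rpredZ // dhomogX /= mdeg1.
elim: n F => [|n IH] F hF; first by rewrite big_ord0 dhomog1.
rewrite big_ord_recl; have := dhomogM (hF ord0) (IH _ (fun k => hF (lift ord0 k))).
by rewrite add1n.
Qed.

Definition grid_pt (i : 'I_D) : 'I_3 -> K :=
  fun j => nth 0 [:: al + (bexp i).1%:R; be + (bexp i).2%:R; 1] j.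

Lemma grid_pt_zero i : g1.@[grid_pt i] = 0 /\ g2.@[grid_pt i] = 0.
Proof.
split; rewrite /grid_form rmorph_prod.
  by rewrite (bigD1 (bexp i).1) //= mevalB mevalZ !mevalXU mulr1 subrr mul0r.
by rewrite (bigD1 (bexp i).2) //= mevalB mevalZ !mevalXU mulr1 subrr mul0r.
Qed.

(** Modulo z the grid forms are x^m and y^m, for which [Psi] would be the identity; the facts on
    [Psi] and on the residue are reduced to that case by descent along powers of z. *)
Definition z_congr (p q : {mpoly K[3]}) := exists r, p - q = 'X_v2 * r.

Lemma z_congr_refl p : z_congr p p.
Proof. by exists 0; rewrite subrr mulr0. Qed.

Lemma z_congrM p q p' q' : z_congr p q -> z_congr p' q' -> z_congr (p * p') (q * q').
Proof.
move=> [r e] [r' e']; exists (r * p' + q * r').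
have -> : p * p' - q * q' = (p - q) * p' + q * (p' - q') by ring.
by rewrite e e'; ring.
Qed.

Lemma z_congrX p q k : z_congr p q -> z_congr (p ^+ k) (q ^+ k).
Proof.
move=> h; elim: k => [|k IH]; first exact: z_congr_refl.
by rewrite !exprS; apply: z_congrM.
Qed.

Lemma grid_form_congr i c : z_congr (grid_form i c) ('X_i ^+ m).
Proof.
rewrite /grid_form -[X in _ ^+ X]card_ord -prodr_const.
elim/big_ind2: _ => [|p q p' q' h h'|k _]; [exact: z_congr_refl|exact: z_congrM|].
by exists (- (c + k%:R)%:MP); rewrite -mul_mpolyC; ring.
Qed.

(** By induction on the degree: [psi_gen] at a differs from the monomial X^a by z times a form of
    degree one less, which is in the image already. *)
Lemma grid_Psi_surj h : in_Psi m g1 g2 h.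
Proof.
have hg1 := grid_form_homog v0 al; have hg2 := grid_form_homog v1 be.
suff homs e p : p \is e.-homog -> in_Psi m g1 g2 p.
  rewrite (pihomog_partitionE (mf := mdeg) (leqnn (msize h))).
  elim/big_ind: _ => [||e _]; [by exists 0; rewrite linear0|exact: in_PsiD|].
  exact/homs/pihomogP.
elim: e {h} p => [|e IH] p hp; rewrite [p]mpolyE big_seq.
all: elim/big_ind: _ => [||a /(dhomog_mf hp) /= ea]; [by exists 0; rewrite linear0|exact: in_PsiD|].
all: apply: in_PsiZ.
  exists 'X_[a]; rewrite PsiX psi_std //; by move: ea; rewrite mdeg3; lia.
have [r er] : z_congr (psi_gen m g1 g2 a) 'X_[a].
  have -> : 'X_[a] = 'X_[mnm3 (a v0 %% m) (a v1 %% m) (a v2)] *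
      ('X_v0 ^+ m) ^+ (a v0 %/ m) * ('X_v1 ^+ m) ^+ (a v1 %/ m) :> {mpoly K[3]}.
    rewrite -!exprM !mpolyXn -!mpolyXD; congr 'X_[_]; apply: mnm3P;
      rewrite !mnmDE !mulmnE !U3E !mnm3E ?mul0n ?mul1n ?addn0 //.
      by rewrite mulnC addnC -divn_eq.
    by rewrite mulnC addnC -divn_eq.
  apply: z_congrM; last exact/z_congrX/grid_form_congr.
  by apply: z_congrM; [exact: z_congr_refl|exact/z_congrX/grid_form_congr].
have hz : ('X_v2 : {mpoly K[3]}) \is 1.-homog by rewrite dhomogX /= mdeg1.
have /(congr1 (pihomog mdeg e.+1)) := er.
rewrite mulrC (pihomogM _ _ hz) /= subn1 /= linearB /= pihomog_dE; last first.
  by rewrite -ea; apply: psi_homog.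
rewrite pihomog_dE ?dhomogX ?/= ?ea ?eqxx // => /eqP.
rewrite subr_eq addrC -subr_eq => /eqP <-.
apply: in_PsiD; first by exists 'X_[a]; rewrite PsiX.
rewrite -scaleN1r; apply: in_PsiZ; rewrite mulrC.
by have := @in_Psi_z K m g1 g2 1 _ (IH _ (pihomogP _ e r)); rewrite expr1.
Qed.

Section GridQuotient.
Variable co : {linear {mpoly K[3]} -> 'rV[K]_D}.
Hypothesis coP : is_coord g1 g2 co.
Variable mult : {mpoly K[3]} -> 'M[K]_D.
Hypothesis row_mult : forall i h, row i (mult h) = co (h * basis_mon K i).

(** Modulo the grid form, x^m h or y^m h of degree 2(m-1) becomes a multiple of z. The residue
    ignores that factor, and what remains has too low a degree. *)
Lemma grid_resid0 i h e : h \is e.-homog -> (e + m = m.-1.*2)%N -> i != v2 ->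
  resid m_gt0 co ('X_i ^+ m * h) = 0.
Proof.
move=> hh em i2; pose c : K := if i == v0 then al else be.
have gi : gs_ideal g1 g2 (grid_form i c).
  apply: ideal_genP; rewrite /c; elim/ord3P: i {c} i2 => //= _; [by left|by right].
have [r er] := grid_form_congr i c.
pose q := pihomog mdeg (m.-1.*2) (r * h * 'X_v2).
have hz : ('X_v2 : {mpoly K[3]}) \is 1.-homog by rewrite dhomogX /= mdeg1.
have eq_q : 'X_i ^+ m * h = grid_form i c * h - q.
  have homX : 'X_i ^+ m * h \is (m.-1.*2).-homog.
    rewrite -em addnC; apply: dhomogM hh; rewrite -{2}[m]mul1n.
    by apply: dhomogMn; rewrite dhomogX /= mdeg1.
  have homg : grid_form i c * h \is (m.-1.*2).-homog.
    by rewrite -em addnC; apply: dhomogM hh; apply: grid_form_homog.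
  rewrite /q -(pihomog_dE homX) -(pihomog_dE homg) -linearB /=; congr (pihomog _ _ _).
  have -> : r * h * 'X_v2 = ('X_v2 * r) * h by ring.
  by rewrite -er; ring.
have gq : resid m_gt0 co (grid_form i c * h) = 0.
  by apply: (resid_ideal m_gt0 coP); rewrite mulrC; apply: ideal_genM.
rewrite eq_q residD gq add0r -scaleN1r residZ /q (pihomogM _ _ hz).
case: ifP => [le|_]; last by rewrite /resid linear0 mxE mulr0.
rewrite [_ * 'X_v2]mulrC; have := resid_zX m_gt0 coP 1; rewrite expr1 => ->.
by rewrite (resid_low m_gt0 coP (pihomogP _ _ _)) ?mulr0 //; lia.
Qed.

(** On the diagonal the product is x^(m-1) y^(m-1). For distinct indices of equal degree, one of the
    two exponents of the product is at least m, and [grid_resid0] applies. *)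
Lemma grid_hankel : hankel m_gt0 co = 1%:M.
Proof.
apply/matrixP => i j; rewrite [LHS]mxE [RHS]mxE.
have [<-|ne] := eqVneq i j.
  have -> : rev_mon K i * basis_mon K i = basis_mon K (top_idx m_gt0).
    rewrite -mpolyXD mnm3D /basis_mon !bexp_top.
    have l1 := ltn_ord (bexp i).1; have l2 := ltn_ord (bexp i).2.
    by rewrite !subnK // -ltnS prednK.
  rewrite eqxx.
  by rewrite /resid (qcoord_basis coP) mxE !eqxx.
case: eqP => // bij; rewrite -mpolyXD mnm3D.
have l1 := ltn_ord (bexp i).1; have l2 := ltn_ord (bexp i).2.
have l3 := ltn_ord (bexp j).1; have l4 := ltn_ord (bexp j).2.
have degs : (m.-1 - (bexp i).1 + (bexp j).1 + (m.-1 - (bexp i).2 + (bexp j).2) = m.-1.*2)%N.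
  by move: bij; rewrite /bdeg -addnn; lia.
have fin k : k != v2 -> (m <= mnm3 (m.-1 - (bexp i).1 + (bexp j).1)
    (m.-1 - (bexp i).2 + (bexp j).2) (0 + 0) k)%N ->
  resid m_gt0 co 'X_[mnm3 (m.-1 - (bexp i).1 + (bexp j).1)
    (m.-1 - (bexp i).2 + (bexp j).2) (0 + 0)] = 0.
  move=> k2 le; set a := mnm3 _ _ _ in le *.
  have lea : (U_(k) *+ m <= a)%MM.
    apply/mnm_lepP => l; rewrite mulmnE mnm1E; case: eqP => [<-|_]; by rewrite ?mul1n ?mul0n.
  rewrite -(submK lea) addmC mpolyXD -mpolyXn.
  apply: (grid_resid0 (e := mdeg (a - U_(k) *+ m)%MM)) k2; first by rewrite dhomogX.
  have := congr1 (@mdeg 3) (submK lea); rewrite mdegD mdegMn mdeg1 mul1n => ->.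
  by rewrite /a mdeg_mnm3 !addn0.
have [lt|ge] := ltnP (bexp i).1 (bexp j).1.
  by apply: (fin v0) => //; rewrite mnm3E; lia.
apply: (fin v1) => //; rewrite mnm3E; move: bij; rewrite /bdeg => bij.
have : (bexp i).1 != (bexp j).1 :> nat.
  apply: contra ne => /eqP e1; apply/eqP/bexp_inj => //; lia.
by move/eqP; lia.
Qed.

Lemma grid_eval e q i : q \is e.-homog ->
  q.@[grid_pt i] = \sum_b co q 0 b * (basis_mon K b).@[grid_pt i].
Proof.
move=> hq; have := qcoord_rep coP hq.
have ev0 p : gs_ideal g1 g2 p -> p.@[grid_pt i] = 0.
  elim/ideal_gen_ind => [|p1 p2 h1 h2|a g]; first exact: meval0.
    by rewrite mevalD h1 h2 addr0.
  have [z1 z2] := grid_pt_zero i.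
  by case=> ->; rewrite mevalM (z1, z2) mulr0.
move/ev0; rewrite mevalB => /eqP; rewrite subr_eq0 => /eqP ->.
rewrite raddf_sum; apply: eq_bigr => b _ /=.
by rewrite mevalZ mevalM rmorphXn /= mevalXU expr1n mul1r.
Qed.

Definition grid_W : 'M[K]_D := \matrix_(b, i) (basis_mon K b).@[grid_pt i].

Lemma grid_mult c h : h \is c.-homog ->
  mult h *m grid_W = grid_W *m diag_mx (\row_i h.@[grid_pt i]).
Proof.
move=> hh; apply/matrixP => b i; rewrite mul_mx_diag !mxE -mevalM.
rewrite mulrC (grid_eval _ (dhomogM hh (basis_mon_homog K b))).
by apply: eq_bigr => k _; rewrite -row_mult !mxE.
Qed.

Lemma sep_grid_pt i : (sep_form K m).@[grid_pt i] =
  al + m%:R * be + ((bexp i).1 + m * (bexp i).2)%:R.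
Proof.
by rewrite /sep_form mevalD mevalZ !mevalXU natrD natrM /grid_pt /=; ring.
Qed.

(** Up to a constant, the value at the vertex (i, j) is i + m j, which has i and j as base m
    digits. *)
Lemma sep_grid_inj : injective (fun i => (sep_form K m).@[grid_pt i]).
Proof.
move=> i j; rewrite !sep_grid_pt => /addrI/eqP; rewrite eqr_nat => /eqP e.
have l1 := ltn_ord (bexp i).1; have l2 := ltn_ord (bexp j).1.
have e1 : (bexp i).1 = (bexp j).1 :> nat.
  by have := congr1 (modn^~ m) e; rewrite ![(_ + m * _)%N]addnC ![(m * _)%N]mulnC !modnMDl !modn_small.
apply: bexp_inj => //; move: e; rewrite e1 => /addnI/eqP.
by rewrite eqn_pmul2l // => /eqP.
Qed.

(** The columns are eigenvectors of the multiplication by [sep_form] with distinct eigenvalues; none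
    is zero, because the basis monomial 1 takes the value 1 at every vertex. *)
Lemma grid_W_unit : grid_W \in unitmx.
Proof.
rewrite -unitmx_tr; have := congr1 trmx (grid_mult (sep_form_homog K m)).
rewrite !trmx_mul tr_diag_mx => e; apply: (eigenrows_unit e).
  by move=> i j; rewrite !mxE; apply: sep_grid_inj.
move=> i; have [b0 b1] := basis_mon0 K m_gt0.
by apply/eqP => /rowP/(_ b0)/eqP; rewrite !mxE b1 meval1 oner_eq0.
Qed.

End GridQuotient.

(** By [grid_mult] the multiplications are diagonalised by [grid_W] with the values at the vertices
    as eigenvalues: those of [sep_form] are distinct, those of f are nonzero by hypothesis. *)
Lemma grid_general_det f : f \is (m.*2 + 3).-homog ->
  (forall i, f.@[grid_pt i] != 0) -> general_det m_gt0 g1 g2 f != 0.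
Proof.
move=> hf fi.
have hg1 := grid_form_homog v0 al; have hg2 := grid_form_homog v1 be.
have sj := grid_Psi_surj.
have [co [coPsi coP]] := exists_coord m_gt0 hg1 hg2 sj.
have [mult row_mult] := exists_mult co.
have det0 := psi_det_neq0 m_gt0 hg1 hg2 sj.
have multE := num_multE m_gt0 hg1 hg2 sj coPsi coP row_mult.
have Wu := grid_W_unit coP row_mult.
rewrite /general_det (num_hankelE m_gt0 hg1 hg2 sj coPsi) (grid_hankel coP).
rewrite !mulf_neq0 //.
- by apply/prodf_neq0.
- by rewrite scalemx1 det_scalar expf_neq0.
- rewrite /num_disc -unitfE -unitmxE; set A := num_mult _ _ _ _ _.
  pose d := \row_i (\det (psi_mx_gen m g1 g2 (m.-1.*2 + 1)) * (sep_form K m).@[grid_pt i]).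
  apply: (@disc_of_diag _ _ A (invmx grid_W) d); rewrite ?unitmx_inv //.
    rewrite /A multE ?sep_form_homog // -scalemxAr.
    apply: (can_inj (mulmxK Wu)); rewrite mulmxKV // -scalemxAl -mulmxA.
    rewrite (grid_mult coP row_mult (sep_form_homog K m)) mulmxA mulVmx // mul1mx.
    by rewrite -linearZ; congr diag_mx; apply/rowP => i; rewrite !mxE.
  move=> i j; rewrite !mxE => /(mulfI (det0 _)); exact: sep_grid_inj.
rewrite multE // detZ mulf_neq0 ?expf_neq0 //.
have := congr1 determinant (grid_mult coP row_mult hf).
rewrite !det_mulmx [RHS]mulrC => /mulIf -> //; last by rewrite -unitfE -unitmxE.
by rewrite det_diag; apply/prodf_neq0 => i _; rewrite mxE.
Qed.

End Grid.

(** * Apolarity *)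

(** [P] is an arbitrary proposition, so the minimum is found by excluded middle; it yields a Waring
    number from any decomposition. *)
Lemma ex_least (P : nat -> Prop) r : P r ->
  exists s, [/\ P s, (forall t, P t -> (s <= t)%N) & (s <= r)%N].
Proof.
elim/ltn_ind: r => r IH Pr.
have [[t [lt Pt]]|nlt] := classic (exists t, (t < r)%N /\ P t).
  have [s [Ps smin sr]] := IH t lt Pt.
  by exists s; split=> //; apply: leq_trans sr (ltnW lt).
exists r; split=> // t Pt; rewrite leqNgt; apply/negP => lt; apply: nlt.
by exists t.
Qed.

Section Apolarity.
Variables (K : numFieldType) (k : nat).
Implicit Types (D E F G : {mpoly K[k]}) (q : 'I_k -> K).

Lemma diff_actE D F : diff_act D F = mlin (fun m => F^`M[m]) D.
Proof. by []. Qed.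

Lemma diff_actDl D E F : diff_act (D + E) F = diff_act D F + diff_act E F.
Proof. by rewrite !diff_actE linearD. Qed.

Lemma diff_actZl c D F : diff_act (c *: D) F = c *: diff_act D F.
Proof. by rewrite !diff_actE linearZ. Qed.

Lemma diff_actX m F : diff_act 'X_[m] F = F^`M[m].
Proof. by rewrite diff_actE mlinX. Qed.

Lemma diff_act_linear D : linear (diff_act D).
Proof.
move=> c F G; rewrite /diff_act scaler_sumr -big_split; apply: eq_bigr => m _ /=.
by rewrite linearP /= scalerDr !scalerA mulrC.
Qed.

HB.instance Definition _ D :=
  GRing.isLinear.Build K {mpoly K[k]} {mpoly K[k]} _ (diff_act D) (diff_act_linear D).

Lemma diff_actM D E F : diff_act (D * E) F = diff_act D (diff_act E F).
Proof.
elim/mpoly_lin_ind: D => [|p p' IH IH'|c p IH|a].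
- by rewrite mul0r !diff_actE !linear0.
- by rewrite mulrDl !diff_actDl IH IH'.
- by rewrite -scalerAl !diff_actZl IH.
elim/mpoly_lin_ind: E => [|p p' IH IH'|c p IH|b].
- by rewrite mulr0 [diff_act 0 F]diff_actE !linear0.
- by rewrite mulrDr !diff_actDl IH IH' linearD.
- by rewrite -scalerAr !diff_actZl IH linearZ.
by rewrite -mpolyXD !diff_actX addmC mderivmDm.
Qed.

Lemma mderivm_homog e m F : F \is e.-homog ->
  (mdeg m <= e)%N -> F^`M[m] \is (e - mdeg m).-homog.
Proof.
move=> hF le; apply/dhomogP => m'; rewrite mcoeff_msupp mcoeff_mderivm => nz.
have : (m + m')%MM \in msupp F.
  by rewrite mcoeff_msupp; apply: contraNneq nz => ->; rewrite mul0rn.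
by move/(dhomog_mf hF) => /=; rewrite mdegD => <-; rewrite addKn.
Qed.

Lemma mderivm_high e m F : F \is e.-homog -> (e < mdeg m)%N -> F^`M[m] = 0.
Proof.
move=> hF lt; apply/mpolyP => m'; rewrite mcoeff_mderivm mcoeff0.
rewrite (dhomog_nemf_coeff hF) ?mul0rn //= mdegD.
by rewrite neq_ltn; apply/orP; right; apply: ltn_addr.
Qed.

Lemma diff_act_pihomog e e' D F : F \is e.-homog -> (e' <= e)%N ->
  pihomog mdeg e' (diff_act D F) = diff_act (pihomog mdeg (e - e') D) F.
Proof.
move=> hF le; elim/mpoly_lin_ind: D => [|p p' IH IH'|c p IH|a].
- by rewrite linear0 !diff_actE !linear0.
- by rewrite linearD !diff_actDl linearD /= IH IH'.
- by rewrite linearZ !diff_actZl linearZ /= IH.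
rewrite pihomogX diff_actX; case: eqP => [/= ea|/= ne].
  rewrite diff_actX pihomog_dE // (_ : e' = (e - mdeg a)%N); last by rewrite ea subKn.
  by apply: mderivm_homog => //; rewrite ea leq_subr.
rewrite diff_actE linear0; have [lt|ge] := ltnP e (mdeg a).
  by rewrite (mderivm_high hF lt) linear0.
rewrite (pihomog_ne0 _ (mderivm_homog hF ge)) //; apply/eqP => h; apply: ne.
by rewrite -h subKn.
Qed.

Lemma diff_act_homog d e D F : D \is d.-homog -> F \is e.-homog -> (d <= e)%N ->
  diff_act D F \is (e - d).-homog.
Proof.
move=> hD hF le; rewrite homog_piE (diff_act_pihomog _ hF) ?leq_subr // subKn //.
by rewrite pihomog_dE.
Qed.

(** The monomial X^m extracts from a form of degree |m| its coefficient at m, times a product of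
    factorials, which is nonzero in characteristic 0. *)
Lemma diff_act_eq0 e G : G \is e.-homog ->
  (forall D, D \is e.-homog -> diff_act D G = 0) -> G = 0.
Proof.
move=> hG h; apply/mpolyP => m; rewrite mcoeff0.
have [em|ne] := eqVneq (mdeg m) e; last by rewrite (dhomog_nemf_coeff hG).
have := h 'X_[m]; rewrite dhomogX /= em eqxx diff_actX => /(_ isT).
move/mpolyP/(_ 0%MM); rewrite mcoeff0 mcoeff_mderivm addm0 => /eqP.
rewrite mulrn_eq0 => /orP[|/eqP //]; rewrite eqn0Ngt prodn_gt0 // => i.
by rewrite ffact_gt0.
Qed.

Definition dual_form q : {mpoly K[k]} := \sum_(j < k) q j *: 'X_j.

Lemma dual_form_homog q : dual_form q \is 1.-homog.
Proof. by apply: rpred_sum => j _; rewrite rpredZ // dhomogX /= mdeg1. Qed.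

Lemma mderiv_dual_form q i e :
  (dual_form q ^+ e)^`M(i) = (e%:R * q i) *: dual_form q ^+ e.-1.
Proof.
have d1 : (dual_form q)^`M(i) = (q i)%:MP.
  rewrite /dual_form linear_sum (bigD1 i) //= mderivZ mderivX mnm1E eqxx.
  rewrite scale1r (_ : (U_(i) - U_(i))%MM = 0%MM); last first.
    by apply/mnmP => j; rewrite mnmBE subnn mnm0E.
  rewrite mpolyX0 big1 ?addr0 => [|j ne]; last first.
    by rewrite mderivZ mderivX mnm1E (negPf ne) scale0r scaler0.
  by rewrite -mul_mpolyC mulr1.
elim: e => [|e IH]; first by rewrite expr0 -mpolyC1 mderivC mul0r scale0r.
rewrite exprS mderivM IH d1 mul_mpolyC -scalerAr.
case: e {IH} => [|e] /=; first by rewrite mul0r scale0r addr0 mul1r.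
by rewrite -exprS -scalerDl; congr (_ *: _); rewrite -[e.+2]add1n natrD; ring.
Qed.

Lemma mderivm_dual_form q e m :
  (dual_form q ^+ e)^`M[m] =
    ((e ^_ mdeg m)%:R * ('X_[m] : {mpoly K[k]}).@[q]) *: dual_form q ^+ (e - mdeg m).
Proof.
elim: (mdeg m) {-2}m (erefl (mdeg m)) => [|d IH] {}m em.
  move/eqP: em; rewrite mdeg_eq0 => /eqP ->.
  by rewrite mderivm0m mdeg0 ffactn0 mpolyX0 meval1 mulr1 scale1r subn0.
have [i mi] : exists i, m i != 0%N.
  apply/existsP; rewrite -[[exists _, _]]negbK negb_exists; apply/negP => /forallP h.
  move: em; rewrite mdegE big1 // => i _; apply/eqP; have := h i; by rewrite negbK.
have def_m : m = (U_(i) + (m - U_(i)))%MM.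
  by rewrite addmC submK // lep1mP.
set m' := (m - U_(i))%MM in def_m.
have em' : mdeg m' = d by move: em; rewrite def_m mdegD mdeg1 add1n => -[].
rewrite def_m addmC mderivmDm IH // em' mderivmU1m mderivZ mderiv_dual_form scalerA.
rewrite mdegD mdeg1 addn1 em' ffactnSr natrM mpolyXD mevalM mevalXU -subn1 -subnDA addn1.
by congr (_ *: _); ring.
Qed.

(** This turns evaluation at points into powers of linear forms. No bound d <= e is required, as the
    falling factorial vanishes beyond it. *)
Lemma diff_act_dual_form q d e D : D \is d.-homog ->
  diff_act D (dual_form q ^+ e) = ((e ^_ d)%:R * D.@[q]) *: dual_form q ^+ (e - d).
Proof.
move=> /dhomogP hD; rewrite [in RHS](mpolyE D) rmorph_sum mulr_sumr scaler_suml.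
rewrite /diff_act !big_seq; apply: eq_bigr => m /hD <- /=.
by rewrite mderivm_dual_form mevalZ scalerA; congr (_ *: _); ring.
Qed.

Section Functional.
Variables (I : finType) (lam : I -> K) (x : I -> 'I_k -> K).
Variable J : {mpoly K[k]} -> Prop.
Let phi D := \sum_i lam i * D.@[x i].
Hypotheses (JD : forall D E, J D -> J E -> J (D + E)) (JM : forall D E, J E -> J (D * E)).
Hypothesis Jhomog : forall e D, J D -> J (pihomog mdeg e D).
Hypothesis J4 : forall D, D \is 4.-homog -> J D -> phi D = 0.
Hypothesis Jdual : forall d D, (d <= 4)%N -> D \is d.-homog ->
  (forall E, E \is (4 - d).-homog -> phi (D * E) = 0) -> J D.
Hypothesis J5 : forall D, D \is 5.-homog -> J D.
Hypothesis J1 : ~ J 1.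

Let J0 : J 0. Proof. by apply: J5; apply: rpred0. Qed.

Let JZ c D : J D -> J (c *: D).
Proof. by rewrite -mul_mpolyC; apply: JM. Qed.

Let phiD D E : phi (D + E) = phi D + phi E.
Proof. by rewrite /phi -big_split; apply: eq_bigr => i _; rewrite mevalD mulrDr. Qed.

Let phiZ c D : phi (c *: D) = c * phi D.
Proof. by rewrite /phi mulr_sumr; apply: eq_bigr => i _; rewrite mevalZ mulrCA. Qed.

Let Jhigh d D : (5 <= d)%N -> D \is d.-homog -> J D.
Proof.
move=> d5 /dhomogP hD; rewrite [D]mpolyE big_seq; elim/big_ind: _ => [||m /hD em]; [exact: J0|exact: JD|].
apply: JZ; elim: d d5 m em {hD D} => // d IH.
rewrite leq_eqVlt => /orP[/eqP <- m em|]; first by apply: J5; rewrite dhomogX /= em.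
rewrite ltnS => d5 m em.
have [i mi] : exists i, m i != 0%N.
  apply/existsP; rewrite -[[exists _, _]]negbK negb_exists; apply/negP => /forallP h.
  move: em; rewrite /= mdegE big1 // => i _; apply/eqP; have := h i; by rewrite negbK.
have def_m : m = (U_(i) + (m - U_(i)))%MM by rewrite addmC submK // lep1mP.
rewrite def_m mpolyXD; apply/JM/IH => //.
by move: em; rewrite {1}def_m /= mdegD mdeg1 add1n => -[].
Qed.

Let Jcomp D : (forall e, J (pihomog mdeg e D)) -> J D.
Proof.
move=> h; rewrite (pihomog_partitionE (mf := mdeg) (leqnn (msize D))).
by elim/big_ind: _ => [||e _]; [exact: J0|exact: JD|].
Qed.

Let F0 : {mpoly K[k]} := \sum_i lam i *: dual_form (x i) ^+ 4.

Let F0_homog : F0 \is 4.-homog.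
Proof.
apply: rpred_sum => i _; rewrite rpredZ //.
by have := dhomogMn 4 (dual_form_homog (x i)); rewrite mul1n.
Qed.

Let diff_act_top D : D \is 4.-homog -> diff_act D F0 = (24%:R * phi D)%:MP.
Proof.
move=> hD; rewrite linear_sum /phi mulr_sumr rmorph_sum; apply: eq_bigr => i _.
rewrite linearZ /= (diff_act_dual_form _ _ hD) subnn expr0 scalerA.
by rewrite alg_mpolyC; congr (_%:MP); rewrite (_ : 4 ^_ 4 = 24)%N //; ring.
Qed.

(** For d <= 4 the form D . F0 has degree 4 - d and is tested against forms E of that degree: E . (D
    . F0) = 4! phi(D E). Beyond degree 4 both sides hold. *)
Let JP_homog d D : D \is d.-homog -> J D <-> diff_act D F0 = 0.
Proof.
move=> hD; have [d4|d5] := leqP d 4; last first.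
  split=> [_|_]; last exact: Jhigh hD.
  rewrite linear_sum big1 // => i _; rewrite linearZ /= (diff_act_dual_form _ _ hD).
  by rewrite ffact_small // mul0r scale0r scaler0.
have hDE E : E \is (4 - d).-homog -> D * E \is 4.-homog.
  by move=> hE; have := dhomogM hD hE; rewrite subnKC.
split=> [JD'|D0].
  apply: (diff_act_eq0 (diff_act_homog hD F0_homog d4)) => E hE.
  rewrite -diff_actM mulrC diff_act_top ?hDE // J4 ?hDE ?mulr0 //.
  by rewrite mulrC; apply: JM.
apply: (Jdual d4 hD) => E hE; have := diff_act_top (hDE E hE).
rewrite mulrC diff_actM D0 linear0 => /esym/eqP; rewrite mpolyC_eq0 mulf_eq0.
by rewrite pnatr_eq0 /= => /eqP.
Qed.

Let JP D : J D <-> diff_act D F0 = 0.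
Proof.
split=> [JD'|D0].
  rewrite (pihomog_partitionE (mf := mdeg) (leqnn (msize D))) diff_actE linear_sum.
  by apply: big1 => e _; apply/(JP_homog (pihomogP _ _ _))/Jhomog.
apply: Jcomp => e; apply/(JP_homog (pihomogP _ _ _)).
have [e4|e5] := leqP e 4.
  rewrite -[e](subKn e4) -(diff_act_pihomog _ F0_homog) ?leq_subr // D0 linear0 //.
by apply/(JP_homog (pihomogP _ _ _)); apply: Jhigh (pihomogP _ _ _).
Qed.

(** If phi vanished on all quartics, duality in degree 0 would put 1 in J. *)
Let exists_socle : exists2 s, s \is 4.-homog & phi s != 0.
Proof.
apply: NNPP => h; apply: J1; apply: (@Jdual 0) => //; first exact: dhomog1.
move=> E hE; rewrite mul1r; apply/eqP/negPn/negP => nz; apply: h.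
by exists E.
Qed.

(** For d < 4 every E of degree 4 - d is a combination of multiples of variables, so D E lies in J
    and phi(D E) = 0; duality then puts D in J. *)
Let socle_low d D : (d != 4)%N -> D \is d.-homog -> in_socle J D -> J D.
Proof.
move=> d4 hD soc; have [lt|ge] := ltnP d 4; last first.
  by apply: Jhigh hD; rewrite ltn_neqAle eq_sym d4.
apply: (Jdual (ltnW lt) hD) => E hE.
have hDE : D * E \is 4.-homog by have := dhomogM hD hE; rewrite subnKC // ltnW.
apply: J4 => //; move: hE => /dhomogP hE; rewrite [E]mpolyE mulr_sumr big_seq.
elim/big_ind: _ => [||m /hE em]; [exact: J0|exact: JD|].
have [i mi] : exists i, m i != 0%N.
  apply/existsP; rewrite -[[exists _, _]]negbK negb_exists; apply/negP => /forallP h.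
  move: em; rewrite /= mdegE big1 => [|i _]; first by lia.
  by apply/eqP; have := h i; rewrite negbK.
have -> : m = ((m - U_(i)) + U_(i))%MM by rewrite submK // lep1mP.
rewrite mpolyXD -scalerAr mulrC -mulrA; apply/JZ/JM; exact: soc.
Qed.

Lemma exists_macaulay_polynomial : exists F, macaulay_polynomial J F.
Proof.
have [s hs phis] := exists_socle; exists F0, 4; split=> //; last first.
  apply/eqP => F00; apply: J1; apply/JP; rewrite F00 linear0 //.
split; first by exists 5 => e D e5 hD; apply: Jhigh hD.
exists s; split=> //.
- by move=> i; apply: J5; apply: (@dhomogM _ _ _ 1 _ 4) => //; rewrite dhomogX /= mdeg1.
- by move=> Js; move: phis; rewrite J4 ?eqxx.
(* Each component of D is again in the socle. Outside degree 4 it lies in J by [socle_low] or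
   [Jhigh]; in degree 4, J is the kernel of phi, and c is chosen so that phi vanishes on the
   difference. *)
move=> D soc; pose c := phi (pihomog mdeg 4 D) / phi s.
exists c; apply: Jcomp => e; rewrite linearB linearZ /=.
have socD : in_socle J (pihomog mdeg e D).
  move=> i; have hX : ('X_i : {mpoly K[k]}) \is 1.-homog by rewrite dhomogX /= mdeg1.
  have := pihomogM e.+1 D hX; rewrite subn1 /= mulrC [_ * 'X_i]mulrC => <-.
  by apply: Jhomog; apply: soc.
have [->|ne] := eqVneq e 4%N.
  rewrite (pihomog_dE hs).
  apply: (@Jdual 4) => // [|E hE]; first by rewrite rpredB ?rpredZ ?pihomogP.
  have [c' ->] : exists c', E = c'%:MP.
    exists E@_0; apply/mpolyP => m; rewrite mcoeffC.
    have [->|nz] := eqVneq m 0%MM; first by rewrite mulr1.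
    by rewrite mulr0 (dhomog_nemf_coeff hE) // mdeg_eq0.
  rewrite mulrC mul_mpolyC phiZ -scaleN1r scalerA phiD phiZ /c.
  by rewrite mulN1r mulNr divfK // subrr mulr0.
rewrite (pihomog_ne0 _ hs) ?scaler0 ?subr0 1?eq_sym //.
exact: (socle_low ne (pihomogP _ _ _)).
Qed.

Lemma macaulay_polynomial_waring F : macaulay_polynomial J F ->
  F \is 4.-homog /\ exists r, waring_number 4 F r /\ (r <= #|I|)%N.
Proof.
move=> [d [[_ [s' [hs' soc' nJs' _]]] Fn0 hF JF]].
have d4 : d = 4%N.
  by apply/eqP/negPn/negP => d4; apply: nJs'; apply: (socle_low d4 hs').
rewrite d4 in hF; split=> //.
have [s hs phis] := exists_socle.
(* Modulo J every quartic D is (phi D / phi s) s, so D . F is a fixed multiple of phi D, just as D .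
   F0 is. *)
have [c def_F] : exists c, F = c *: F0.
  have hsF := diff_act_homog hs hF (leqnn 4); rewrite subnn in hsF.
  pose a := (diff_act s F)@_0.
  have sF : diff_act s F = a%:MP.
    apply/mpolyP => m; rewrite mcoeffC.
    have [->|nz] := eqVneq m 0%MM; first by rewrite mulr1.
    by rewrite mulr0 (dhomog_nemf_coeff hsF) // mdeg_eq0.
  exists (a / (24%:R * phi s)); apply/eqP; rewrite -subr_eq0; apply/eqP.
  apply: (@diff_act_eq0 4); first by rewrite rpredB ?rpredZ.
  move=> D hD; rewrite linearB linearZ /= diff_act_top //.
  have : J (D - (phi D / phi s) *: s).
    apply/JP; rewrite diff_act_top ?rpredB ?rpredZ //.
    by rewrite -scaleN1r phiD !phiZ divfK // mulN1r subrr mulr0 mpolyC0.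
  move/JF; rewrite -scaleN1r diff_actDl !diff_actZl sF => /eqP.
  rewrite scaleN1r subr_eq0 => /eqP ->.
  rewrite -!mul_mpolyC -!mpolyCM -mpolyCB (_ : _ - _ = 0) ?mpolyC0 //.
  by field; rewrite phis.
have c0 : c != 0 by apply: contraNneq Fn0 => c0; rewrite def_F c0 scale0r.
(* A Waring decomposition has nonzero coefficients, so the points of weight zero are dropped; what
   results is an upper bound only. *)
pose A := [pred i | lam i != 0].
have dec : waring_decomposition 4 F #|A|.
  exists (fun j => c * lam (enum_val j)), (fun j => dual_form (x (enum_val j))); split.
  - by move=> j; rewrite mulf_neq0 //; have := enum_valP j.
  - by move=> j; apply: dual_form_homog.
  rewrite def_F /F0 scaler_sumr (bigID A) /= [X in _ + X]big1 ?addr0; last first.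
    by move=> i /negPn/eqP ->; rewrite scale0r scaler0.
  rewrite big_enum_val /=.
  by apply: eq_bigr => j _; rewrite scalerA.
have [r [h1 h2 h3]] := ex_least dec.
by exists r; split; [split|apply: leq_trans h3 (max_card _)].
Qed.

End Functional.
End Apolarity.

(** * Veronese embedding and linear sections *)

Lemma meval_homog (K : fieldType) (n d : nat) (P : {mpoly K[n]}) c w :
  P \is d.-homog -> P.@[fun j => c * w j] = c ^+ d * P.@[w].
Proof.
move=> /dhomogP hP; rewrite !mevalE mulr_sumr !big_seq; apply: eq_bigr => m /hP <-.
under eq_bigr do rewrite exprMn.
by rewrite big_split /= prodrXr -mdegE mulrCA.
Qed.

Section Composition.
Variables (K : fieldType) (n k : nat) (t : n.-tuple {mpoly K[k]}).

Lemma comp_mpolyA l (t' : l.-tuple {mpoly K[n]}) P :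
  (P \mPo t') \mPo t = P \mPo [tuple tnth t' i \mPo t | i < l].
Proof.
elim/mpoly_ring_ind: P => [c|i|p q IHp IHq|p q IHp IHq].
- by rewrite !comp_mpolyC.
- by rewrite !comp_mpolyXU -!tnth_nth tnth_mktuple.
- by rewrite !comp_mpolyD; congr (_ + _).
- by rewrite !rmorphM; congr (_ * _).
Qed.

Variable c : nat.
Hypotheses (c_gt0 : (0 < c)%N) (ht : forall i, tnth t i \is c.-homog).

Lemma comp_homogX a : 'X_[a] \mPo t \is (mdeg a * c).-homog.
Proof.
rewrite comp_mpolyX mdegE big_distrl /=.
elim/big_ind2: _ => [|p d q e hp hq|i _]; [exact: dhomog1|exact: dhomogM|].
by rewrite mulnC; apply: dhomogMn.
Qed.

Lemma comp_pihomog d P : pihomog mdeg (d * c) (P \mPo t) = pihomog mdeg d P \mPo t.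
Proof.
elim/mpoly_lin_ind: P => [|p q IHp IHq|a p IH|a].
- by rewrite !(comp_mpoly0, linear0).
- by rewrite !(comp_mpolyD, linearD) /= IHp IHq.
- by rewrite !(comp_mpolyZ, linearZ) /= IH.
rewrite pihomogX; case: eqP => [/= <-|/eqP ne].
  by rewrite pihomog_dE // comp_homogX.
by rewrite comp_mpoly0 (pihomog_ne0 _ (comp_homogX a)) // eqn_pmul2r.
Qed.

Lemma comp_homog d P : P \is d.-homog -> P \mPo t \is (d * c).-homog.
Proof. by move=> hP; rewrite homog_piE comp_pihomog pihomog_dE. Qed.

End Composition.

(** * Coordinates on the subspace cut out by two linear forms *)

Section LinearSubstitution.
Variable K : fieldType.

(** [Ga] completes the rows of [E] to an invertible matrix with inverse (H La). Thus [La]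
    parametrises the subspace E = 0, and [La *m Ga] is the identity modulo the two forms. *)
Lemma complete_rows r (E : 'M[K]_(2, 2 + r)) : row_free E ->
  exists (La : 'M[K]_(2 + r, r)) (Ga : 'M[K]_(r, 2 + r)) (H : 'M[K]_(2 + r, 2)),
    [/\ E *m La = 0, Ga *m La = 1%:M & La *m Ga + H *m E = 1%:M].
Proof.
move=> freeE; have er : \rank (E^C)%MS = r.
  by rewrite mxrank_compl (eqP freeE) addKn.
pose Ga := castmx (er, erefl) (row_base (E^C)%MS); pose M := col_mx E Ga.
have Mu : M \in unitmx.
  rewrite -row_full_unit -sub1mx; apply: submx_trans (_ : (E + E^C <= M)%MS).
    by rewrite sub1mx addsmx_compl_full.
  by rewrite -addsmxE addsmxS // eqmx_cast eq_row_base.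
pose H := lsubmx (invmx M); pose La := rsubmx (invmx M).
have defB : invmx M = row_mx H La by rewrite hsubmxK.
exists La, Ga, H; have := mulmxV Mu; rewrite defB mul_col_row scalar_mx_block.
move=> /eq_block_mx [_ -> _ ->]; split=> //.
by rewrite -scalar_mx_block -(mulVmx Mu) defB /M mul_row_col addrC.
Qed.

Definition linear_tuple n k (M : 'M[K]_(n, k)) : n.-tuple {mpoly K[k]} :=
  [tuple linear_form (M j) | j < n].

Lemma linear_form_comp n k (w : 'I_n -> K) (M : 'M[K]_(n, k)) :
  linear_form w \mPo linear_tuple M = linear_form (fun i => \sum_j w j * M j i).
Proof.
transitivity (\sum_(j < n) \sum_(i < k) (w j * M j i) *: 'X_i : {mpoly K[k]}).
  rewrite /linear_form raddf_sum; apply: eq_bigr => j _.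
  rewrite /= comp_mpolyZ comp_mpolyXt tnth_mktuple scaler_sumr.
  by apply: eq_bigr => i _; rewrite scalerA.
by rewrite exchange_big; apply: eq_bigr => i _; rewrite /= scaler_suml.
Qed.

Lemma eq_linear_form n (w w' : 'I_n -> K) : w =1 w' -> linear_form w = linear_form w'.
Proof. by move=> e; apply: eq_bigr => j _; rewrite e. Qed.

Lemma linear_form_delta n (i : 'I_n) : linear_form (fun j => (i == j)%:R : K) = 'X_i.
Proof.
rewrite /linear_form (bigD1 i) //= eqxx scale1r big1 ?addr0 // => j ne.
by rewrite eq_sym (negPf ne) scale0r.
Qed.

Lemma linear_form_homog n (w : 'I_n -> K) : linear_form w \is 1.-homog.
Proof. by apply: rpred_sum => j _; rewrite rpredZ // dhomogX /= mdeg1. Qed.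

Lemma linear_form0 n : linear_form (fun=> 0 : K) = 0 :> {mpoly K[n]}.
Proof. by apply: big1 => j _; rewrite scale0r. Qed.

Lemma linear_formD n (w w' : 'I_n -> K) c c' :
  c *: linear_form w + c' *: linear_form w' = linear_form (fun j => c * w j + c' * w' j).
Proof.
rewrite /linear_form !scaler_sumr -big_split; apply: eq_bigr => j _ /=.
by rewrite scalerDl !scalerA.
Qed.

Lemma subst_congr n (G : {mpoly K[n]} -> Prop) (t : n.-tuple {mpoly K[n]}) P :
  (forall j, ideal_gen G ('X_j - tnth t j)) -> ideal_gen G (P - (P \mPo t)).
Proof.
move=> ht; elim/mpoly_ring_ind: P => [c|j|p q IHp IHq|p q IHp IHq].
- by rewrite comp_mpolyC subrr; apply: ideal_gen0.
- by rewrite comp_mpolyXt.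
- by rewrite comp_mpolyD opprD addrACA; apply: ideal_genD.
rewrite rmorphM /=; set p' := p \mPo t in IHp *; set q' := q \mPo t in IHq *.
have -> : p * q - p' * q' = q * (p - p') + p' * (q - q') by ring.
by apply: ideal_genD; apply: ideal_genM.
Qed.

Lemma independent_section_coordinates N (a b : 'I_N.+1 -> K) : (0 < N)%N ->
  (forall c1 c2, c1 *: linear_form a + c2 *: linear_form b = 0 -> c1 = 0 /\ c2 = 0) ->
  exists L, section_coordinates (linear_form a) (linear_form b) L.
Proof.
case: N a b => // r a b _ indep.
pose E : 'M[K]_(2, 2 + r) := \matrix_(i, j) if i == 0 then a j else b j.
have sumE (v : 'rV[K]_2) j : (v *m E) 0 j = v 0 0 * a j + v 0 1 * b j.
  by rewrite mxE !big_ord_recl big_ord0 addr0 !mxE /=; congr (_ + v 0 _ * _); apply: val_inj.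
have freeE : row_free E.
  rewrite -kermx_eq0; apply/eqP/row_matrixP => i0; rewrite row0.
  set v := row i0 _; have vE : v *m E = 0 by rewrite -row_mul mulmx_ker row0.
  have [|h0 h1] := indep (v 0 0) (v 0 1).
    rewrite linear_formD -[RHS](linear_form0 r.+2); apply: eq_linear_form => j.
    by rewrite -sumE vE mxE.
  apply/rowP; case=> [[|[|//]] lt]; rewrite [RHS]mxE.
    by rewrite -[RHS]h0; congr (v 0 _); apply: val_inj.
  by rewrite -[RHS]h1; congr (v 0 _); apply: val_inj.
have [La [Ga [H [EL GL LG]]]] := complete_rows freeE.
pose L : r.+2.-tuple {mpoly K[r]} := @linear_tuple r.+2 r La.
pose T : r.-tuple {mpoly K[r.+2]} := @linear_tuple r r.+2 Ga.
(* P and its image under L followed by T agree modulo the two forms, since they do on the variables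
   by [LG]. This determines the kernel of the substitution L. *)
have LT P : ideal_gen (fun Q => Q = linear_form a \/ Q = linear_form b)
    (P - ((P \mPo L) \mPo T)).
  rewrite comp_mpolyA; apply: subst_congr => j.
  have -> : 'X_j - tnth [tuple tnth L i \mPo T | i < r.+2] j =
      H j 0 *: linear_form a + H j 1 *: linear_form b.
    rewrite !tnth_mktuple linear_form_comp linear_formD.
    apply/eqP; rewrite subr_eq; apply/eqP.
    rewrite -[X in X + _]scale1r -[X in _ + X]scale1r linear_formD -[LHS]linear_form_delta.
    apply: eq_linear_form => l; move/matrixP/(_ j l): LG; rewrite !mxE => <-; rewrite !mul1r addrC.
    congr (_ + _); rewrite !big_ord_recl big_ord0 addr0 !mxE /=.
    by congr (_ + H j _ * _); apply: val_inj.
  by apply: ideal_genD; apply/ideal_genZ/ideal_genP; [left|right].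
have EL0 i : linear_form (E i) \mPo L = 0.
  rewrite linear_form_comp -[RHS](linear_form0 r); apply: eq_linear_form => l.
  by move/matrixP/(_ i l): EL; rewrite !mxE.
exists L; split.
- by move=> i; rewrite tnth_mktuple; apply: linear_form_homog.
- move=> P; exists (P \mPo T); rewrite comp_mpolyA -[RHS]comp_mpoly_id.
  congr (P \mPo _); apply: eq_mktuple => i; rewrite tnth_mktuple linear_form_comp.
  rewrite -linear_form_delta; apply: eq_linear_form => l.
  by move/matrixP/(_ i l): GL; rewrite !mxE.
move=> P; split=> [P0|]; first by have := LT P; rewrite P0 comp_mpoly0 subr0.
elim/ideal_gen_ind => [|p q hp hq|c g eg]; first exact: comp_mpoly0.
  by rewrite comp_mpolyD hp hq addr0.
rewrite rmorphM /=; suff -> : g \mPo L = 0 by rewrite mulr0.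
case: eg => ->; [rewrite -[RHS](EL0 0)|rewrite -[RHS](EL0 1)]; congr (_ \mPo L);
  by apply: eq_linear_form => j; rewrite mxE.
Qed.

End LinearSubstitution.

Section Veronese.
Variables (K : numClosedFieldType) (m N : nat) (mon : 'I_N.+1 -> 'X_{1..3}).
Hypotheses (m_gt0 : (0 < m)%N) (mon_deg : forall j, mdeg (mon j) = m).
Hypotheses (mon_inj : injective mon) (mon_surj : forall a, mdeg a = m -> exists j, mon j = a).
Local Notation D := #|{: 'I_m * 'I_m}|.

Definition theta_tuple : N.+1.-tuple {mpoly K[3]} := [tuple 'X_[mon j] | j < N.+1].
Local Notation theta P := (P \mPo theta_tuple).

Let theta_tuple_homog j : tnth theta_tuple j \is m.-homog.
Proof. by rewrite tnth_mktuple dhomogX /= mon_deg. Qed.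

Lemma meval_theta (P : {mpoly K[N.+1]}) v :
  (theta P).@[v] = P.@[fun j => ('X_[mon j] : {mpoly K[3]}).@[v]].
Proof. by rewrite comp_mpoly_meval; apply: meval_eq => j; rewrite tnth_mktuple. Qed.

Lemma mnm_sub_deg (a : 'X_{1..3}) e : (e <= mdeg a)%N ->
  exists2 b : 'X_{1..3}, (b <= a)%MM & mdeg b = e.
Proof.
rewrite mdeg3 => le.
pose b0 := minn e (a v0); pose b1 := minn (e - b0) (a v1).
exists (mnm3 b0 b1 (e - b0 - b1)); last by rewrite mdeg_mnm3 /b1 /b0; lia.
by apply/mnm_lepP; elim/ord3P; rewrite mnm3E /b1 /b0; lia.
Qed.

(** Projective normality of the Veronese surface: a monomial of degree d m splits into d monomials
    of degree m. *)
Lemma theta_surj d (h : {mpoly K[3]}) : h \is (d * m).-homog ->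
  exists2 P, P \is d.-homog & theta P = h.
Proof.
move=> /dhomogP hh; rewrite [h]mpolyE big_seq.
elim/big_ind: _ => [|p q [P hP <-] [Q hQ <-]|a /hh /= ea].
- by exists 0; rewrite ?rpred0 ?comp_mpoly0.
- by exists (P + Q); rewrite ?rpredD ?comp_mpolyD.
suff [P hP e] : exists2 P, P \is d.-homog & theta P = 'X_[a].
  by exists (h@_a *: P); rewrite ?rpredZ ?comp_mpolyZ ?e.
elim: d a ea {hh} => [|d IH] a ea.
  exists 1; first exact: dhomog1.
  by move/eqP: ea; rewrite mul0n mdeg_eq0 comp_mpoly1 => /eqP ->; rewrite mpolyX0.
have [|b ba /mon_surj [j def_b]] := @mnm_sub_deg a m; first by rewrite ea mulSn leq_addr.
have def_a : a = (b + (a - b))%MM by rewrite addmC submK.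
have [|P hP eP] := IH (a - b)%MM.
  by move: ea; rewrite {1}def_a mdegD -def_b mon_deg mulSn => /addnI.
exists ('X_j * P); last by rewrite rmorphM /= comp_mpolyXt tnth_mktuple eP def_b -mpolyXD -def_a.
by apply: (@dhomogM _ _ _ 1) => //; rewrite dhomogX /= mdeg1.
Qed.

Lemma theta_linear_form (a : 'I_N.+1 -> K) :
  theta (linear_form a) = \sum_j a j *: 'X_[mon j].
Proof.
rewrite /linear_form linear_sum; apply: eq_bigr => j _.
by rewrite linearZ /= comp_mpolyXt tnth_mktuple.
Qed.

Lemma theta_linear_form_homog a : theta (linear_form a) \is m.-homog.
Proof. by rewrite theta_linear_form rpred_sum // => j _; rewrite rpredZ // dhomogX /= mon_deg. Qed.

Lemma theta_coef g : g \is m.-homog -> theta (linear_form (fun j => g@_(mon j))) = g.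
Proof.
move=> hg; apply/mpolyP => a.
have [/mon_surj [j <-]|ne] := eqVneq (mdeg a) m; last first.
  by rewrite !(dhomog_nemf_coeff _ ne) // theta_linear_form_homog.
rewrite theta_linear_form raddf_sum (bigD1 j) //= mcoeffZ mcoeffX eqxx mulr1.
rewrite big1 ?addr0 // => l ne; rewrite mcoeffZ mcoeffX (inj_eq mon_inj) (negPf ne).
by rewrite mulr0.
Qed.

Section Curve.
Variables (f : {mpoly K[3]}) (X : ('I_N.+1 -> K) -> Prop).
Hypothesis f_smooth : smooth_plane_curve (m.*2 + 3) f.
Hypothesis XP : forall w, X w <-> exists (v : 'I_3 -> K) (c : K), [/\ nonzero_vec v, f.@[v] = 0, c != 0 &
  forall j, w j = c * ('X_[mon j] : {mpoly K[3]}).@[v]].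
Variables eta1 eta2 : {mpoly K[N.+1]}.
Hypotheses (eta1_homog : eta1 \is 1.-homog) (eta2_homog : eta2 \is 1.-homog).
Local Notation g1 := (theta eta1).
Local Notation g2 := (theta eta2).

Let f_homog : f \is (m.*2 + 3).-homog. Proof. by case: f_smooth. Qed.

Lemma smooth_curve_neq0 : f != 0.
Proof.
apply/eqP => f0; have := f_smooth; rewrite f0 => -[_ /(_ (fun=> 1))].
case=> [||i]; [by exists v0; rewrite oner_eq0|by rewrite meval0|].
by rewrite mderiv0 meval0 eqxx.
Qed.

(** P vanishes on X exactly when its pullback vanishes on C, and then smoothness makes the pullback
    divisible by f. *)
Lemma curve_ideal d (P : {mpoly K[N.+1]}) : P \is d.-homog ->
  (forall w, X w -> P.@[w] = 0) <-> exists q, theta P = q * f.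
Proof.
move=> hP; split=> [van|[q eq_q] w /XP [v [c [_ fv _ ew]]]].
  apply: (@smooth_hypersurface_dvd K 3 isT (m.*2 + 3) f (theta P)) => //.
  - by rewrite addn3.
  - exact: smooth_curve_neq0.
  - by case: f_smooth.
  move=> v vn fv; rewrite meval_theta; apply/van/XP.
  by exists v, 1; split=> // [|j]; rewrite ?oner_eq0 ?mul1r.
rewrite (meval_eq _ ew) (meval_homog _ _ hP) -meval_theta eq_q mevalM fv.
by rewrite !mulr0.
Qed.

Let g1_homog : g1 \is m.-homog.
Proof. by have := comp_homog m_gt0 theta_tuple_homog eta1_homog; rewrite mul1n. Qed.

Let g2_homog : g2 \is m.-homog.
Proof. by have := comp_homog m_gt0 theta_tuple_homog eta2_homog; rewrite mul1n. Qed.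

Lemma fgs_idealP q : fgs_ideal g1 g2 f q -> exists a b c, q = a * f + b * g1 + c * g2.
Proof.
elim/ideal_gen_ind => [|p p' [a [b [c ->]]] [a' [b' [c' ->]]]|a g].
- by exists 0, 0, 0; rewrite !mul0r !addr0.
- by exists (a + a'), (b + b'), (c + c'); ring.
case=> ->; [exists a, 0, 0|exists 0, a, 0|exists 0, 0, a]; ring.
Qed.

(** For the converse, write the component of degree d m of the pullback as a f + b g1 + c g2 with
    homogeneous a, b, c. Here b and c have degree (d-1) m or vanish, so they lift to forms B, C on
    P^N; the pullback of P_d - B eta1 - C eta2 is then a multiple of f, hence that form vanishes on
    X. *)
Lemma section_ideal_theta P :
  section_ideal X eta1 eta2 P <-> fgs_ideal g1 g2 f (theta P).
Proof.
split.
  elim/ideal_gen_ind => [|p q hp hq|a g].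
  - by rewrite comp_mpoly0; apply: ideal_gen0.
  - by rewrite comp_mpolyD; apply: ideal_genD.
  move=> hg; rewrite rmorphM /=; apply: ideal_genM; case: hg => [|->|->]; last first.
  - by apply: ideal_genP; constructor 3.
  - by apply: ideal_genP; constructor 2.
  elim/ideal_gen_ind => [|p q hp hq|b g' [[d hg'] van]].
  - by rewrite comp_mpoly0; apply: ideal_gen0.
  - by rewrite comp_mpolyD; apply: ideal_genD.
  have [q eq_q] := (curve_ideal hg').1 van.
  by rewrite rmorphM /= eq_q mulrA; apply/ideal_genM/ideal_genP; constructor 1.
move=> hI; rewrite (pihomog_partitionE (mf := mdeg) (leqnn (msize P))).
apply: ideal_gen_sum => d _; set Q := pihomog _ _ P.
have hQ : Q \is (d : nat).-homog by apply: pihomogP.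
have [a [b [c def_q]]] := fgs_idealP hI.
have := comp_pihomog m_gt0 theta_tuple_homog d P.
rewrite def_q !linearD /= (pihomogM _ _ f_homog) (pihomogM _ _ g1_homog) (pihomogM _ _ g2_homog).
have gen_f a' : exists2 A, A \is (d : nat).-homog & (exists q, theta A = q * f) /\ theta A =
    if (m.*2 + 3 <= d * m)%N then pihomog mdeg (d * m - (m.*2 + 3)) a' * f else 0.
  case: ifP => [le|_]; last first.
    by exists 0; rewrite ?rpred0 //; split; [exists 0; rewrite mul0r comp_mpoly0|rewrite comp_mpoly0].
  set h := pihomog _ _ _ * f; have [|A hA eA] := @theta_surj d h.
    by have := dhomogM (pihomogP mdeg (d * m - (m.*2 + 3)) a') f_homog; rewrite subnK.
  by exists A => //; rewrite eA; split=> //; exists (pihomog mdeg (d * m - (m.*2 + 3)) a').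
have gen_g b' eta : eta \is 1.-homog -> exists2 B, B * eta \is (d : nat).-homog & theta (B * eta) =
    if (m <= d * m)%N then pihomog mdeg (d * m - m) b' * theta eta else 0.
  move=> heta; case: ifP => [le|_]; last first.
    by exists 0; rewrite mul0r ?rpred0 ?comp_mpoly0.
  case: (d : nat) le => [|d']; first by rewrite mul0n leqNgt m_gt0.
  move=> _; rewrite mulSn addKn.
  have [B hB eB] := theta_surj (pihomogP mdeg (d' * m) b').
  exists B; last by rewrite rmorphM /= eB.
  by have := dhomogM hB heta; rewrite addn1.
have [A hA [fA <-]] := gen_f a; have [B hB <-] := gen_g b _ eta1_homog.
have [C hC <-] := gen_g c _ eta2_homog.
rewrite -/Q => eQ.
have -> : Q = 1 * (Q - B * eta1 - C * eta2) + (B * eta1 + C * eta2) by ring.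
apply: ideal_genD; last by apply: ideal_genD; apply/ideal_genM/ideal_genP; [constructor 2|constructor 3].
apply/ideal_genM/ideal_genP; constructor 1; apply: ideal_genP.
have hR : Q - B * eta1 - C * eta2 \is (d : nat).-homog by rewrite !rpredB.
split; first by exists d.
apply/(curve_ideal hR); have [q eq_q] := fA; exists q.
by rewrite !linearB /= -eQ eq_q; ring.
Qed.

Lemma fgs_proper : ~ fgs_ideal g1 g2 f 1.
Proof.
move=> h; have ev0 c (p : {mpoly K[3]}) : (0 < c)%N -> p \is c.-homog -> p@_0%MM = 0 :> K.
  by move=> c0 hp; rewrite (dhomog_nemf_coeff hp) //= mdeg0 eq_sym -lt0n.
have : (1 : {mpoly K[3]})@_0%MM = 0.
  have [a [b [c ->]]] := fgs_idealP h.
  rewrite !mcoeffD !rmorphM /= (ev0 _ _ _ f_homog) ?addn3 //.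
  by rewrite (ev0 _ _ _ g1_homog) // (ev0 _ _ _ g2_homog) // !mulr0 !addr0.
by move/eqP; rewrite mcoeff1 eqxx oner_eq0.
Qed.

Section Coordinates.
Variable L : N.+1.-tuple {mpoly K[N.-1]}.
Hypothesis LP : section_coordinates eta1 eta2 L.
Local Notation J := (section_ideal_in X eta1 eta2 L).

Let L_homog i : tnth L i \is 1.-homog. Proof. by case: LP. Qed.

(** Membership does not depend on the chosen lift: two lifts differ by an element of (eta1, eta2),
    which the section ideal contains. *)
Lemma section_ideal_inE P : J (P \mPo L) <-> fgs_ideal g1 g2 f (theta P).
Proof.
split=> [[Q hQ eQ]|hP]; last by exists P => //; apply/section_ideal_theta.
apply/section_ideal_theta; rewrite -[P](subrK Q); apply: ideal_genD => //.
have : (P - Q) \mPo L = 0 by rewrite comp_mpolyB eQ subrr.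
case: LP => _ _ ker /ker; elim/ideal_gen_ind => [|p q hp hq|a g eg].
- exact: ideal_gen0.
- exact: ideal_genD.
by apply/ideal_genM/ideal_genP; case: eg => ->; [constructor 2|constructor 3].
Qed.

Lemma coordinates_lift d E : E \is d.-homog -> exists2 P, P \is d.-homog & P \mPo L = E.
Proof.
move=> hE; case: LP => _ /(_ E) [P eP] _; exists (pihomog mdeg d P).
  exact: pihomogP.
have := comp_pihomog (isT : (0 < 1)%N) L_homog d P.
by rewrite muln1 => <-; rewrite eP pihomog_dE.
Qed.

(** The coordinates of y are the values at y of lifts of the variables; other lifts would change
    them by elements of (eta1, eta2), which vanish at y. *)
Lemma coordinates_point y : eta1.@[y] = 0 -> eta2.@[y] = 0 ->
  exists q, forall P, P.@[y] = (P \mPo L).@[q].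
Proof.
move=> y1 y2; case: (LP) => _ surj ker.
have [T hT] := fin_all_exists (fun j : 'I_N.-1 => surj 'X_j).
exists (fun j => (T j).@[y]) => P; pose t := [tuple T j | j < N.-1].
have : (P - ((P \mPo L) \mPo t)) \mPo L = 0.
  rewrite comp_mpolyB comp_mpolyA.
  have -> : [tuple tnth t i \mPo L | i < N.-1] = [tuple 'X_i | i < N.-1].
    by apply: eq_mktuple => i; rewrite tnth_mktuple hT.
  by rewrite comp_mpoly_id subrr.
have van p : ideal_gen (fun Q => Q = eta1 \/ Q = eta2) p -> p.@[y] = 0.
  elim/ideal_gen_ind => [|p1 p2 h1 h2|a g [->|->]]; first exact: meval0.
  - by rewrite mevalD h1 h2 addr0.
  - by rewrite mevalM y1 mulr0.
  - by rewrite mevalM y2 mulr0.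
move/ker/van; rewrite mevalB => /eqP; rewrite subr_eq0 => /eqP ->.
by rewrite comp_mpoly_meval; apply: meval_eq => j; rewrite tnth_mktuple.
Qed.

(** The points [x i] satisfy g1 = g2 = 0, so their Veronese images satisfy eta1 = eta2 = 0 and have
    coordinates [q i] in [L]. The functional on plane forms thus becomes a combination of m^2
    evaluations on T, to which apolarity applies. *)
Lemma section_macaulay :
  general_det m_gt0 g1 g2 f != 0 ->
  (exists F, macaulay_polynomial J F) /\
  forall F, macaulay_polynomial J F -> F \is 4.-homog /\
    exists r, waring_number 4 F r /\ (r <= m ^ 2)%N.
Proof.
move=> gen; have [lam [x /= [h4 hdual h5 hx]]] :=
  complete_intersection_duality g1_homog g2_homog f_homog gen.
have qP i : exists q, forall P : {mpoly K[N.+1]}, (theta P).@[x i] = (P \mPo L).@[q].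
  have [x1 x2] := hx i; rewrite meval_theta in x1; rewrite meval_theta in x2.
  by have [q hq] := coordinates_point x1 x2; exists q => P; rewrite meval_theta.
have [q hq] := fin_all_exists qP.
have phiE P : \sum_i lam i * (P \mPo L).@[q i] = \sum_i lam i * (theta P).@[x i].
  by apply: eq_bigr => i _; rewrite hq.
have surj E : exists P, P \mPo L = E by case: LP => _ /(_ E).
have thom d P : P \is d.-homog -> theta P \is (d * m).-homog.
  exact: comp_homog m_gt0 theta_tuple_homog _ _.
have JD E E' : J E -> J E' -> J (E + E').
  have [P <-] := surj E; have [P' <-] := surj E'.
  rewrite -comp_mpolyD !section_ideal_inE comp_mpolyD; exact: ideal_genD.
have JM E E' : J E' -> J (E * E').
  have [P <-] := surj E; have [P' <-] := surj E'.
  by rewrite -rmorphM !section_ideal_inE rmorphM; apply: ideal_genM.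
have Jhomog e E : J E -> J (pihomog mdeg e E).
  have [P <-] := surj E; rewrite -[X in pihomog mdeg X]muln1 comp_pihomog //.
  rewrite !section_ideal_inE -(comp_pihomog m_gt0 theta_tuple_homog).
  apply: ideal_gen_pihomog => g [->|->|->]; [by exists (m.*2 + 3)%N|by exists m|by exists m].
have J4 E : E \is 4.-homog -> J E -> \sum_i lam i * E.@[q i] = 0.
  move=> hE; have [P hP <-] := coordinates_lift hE.
  by rewrite section_ideal_inE phiE => hI; apply: h4 => //; apply: thom.
have Jdual d E : (d <= 4)%N -> E \is d.-homog ->
    (forall E', E' \is (4 - d).-homog -> \sum_i lam i * (E * E').@[q i] = 0) -> J E.
  move=> d4 hE; have [P hP <-] := coordinates_lift hE => orth.
  apply/section_ideal_inE; apply: (hdual d) => //; first exact: thom.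
  move=> h' /theta_surj [P' hP' <-]; rewrite -rmorphM /= -phiE rmorphM /=.
  apply: orth; have := comp_homog (isT : (0 < 1)%N) L_homog hP'.
  by rewrite muln1.
have J5 E : E \is 5.-homog -> J E.
  move=> hE; have [P hP <-] := coordinates_lift hE.
  by apply/section_ideal_inE/h5/thom.
have J1 : ~ J 1.
  by rewrite -(comp_mpoly1 L) section_ideal_inE comp_mpoly1; apply: fgs_proper.
split; first exact: exists_macaulay_polynomial JD JM Jhomog J4 Jdual J5 J1.
move=> F /(macaulay_polynomial_waring JD JM Jhomog J4 Jdual J5 J1) [hF [r [wr rle]]].
split=> //; exists r; split=> //; apply: leq_trans rle _.
by rewrite !card_ord card_prod !card_ord mulnn.
Qed.

End Coordinates.
End Curve.

Hypothesis N_gt0 : (0 < N)%N.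

(** A relation between the linear forms gives Psi(c1 x^m + c2 y^m) = c1 g1 + c2 g2 = 0, so c1 = c2 =
    0 by injectivity of [Psi]. *)
Lemma exists_section_coordinates (a b : 'I_N.+1 -> K) :
  (forall h, in_Psi m (theta (linear_form a)) (theta (linear_form b)) h) ->
  exists L, section_coordinates (linear_form a) (linear_form b) L.
Proof.
move=> surj; apply: (independent_section_coordinates N_gt0).
set g1 := theta (linear_form a) in surj; set g2 := theta (linear_form b) in surj.
have hg1 : g1 \is m.-homog by apply: theta_linear_form_homog.
have hg2 : g2 \is m.-homog by apply: theta_linear_form_homog.
move=> c1 c2 /(congr1 (comp_mpoly theta_tuple)); rewrite comp_mpoly0 comp_mpolyD !comp_mpolyZ.
pose h : {mpoly K[3]} := c1 *: 'X_[mnm3 m 0 0] + c2 *: 'X_[mnm3 0 m 0].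
have -> : c1 *: g1 + c2 *: g2 = Psi m g1 g2 h.
    rewrite linearD !linearZ /= -['X_[mnm3 m 0 0]]mulr1 -['X_[mnm3 0 m 0]]mulr1.
  have Psi1 : Psi m g1 g2 1 = 1 by rewrite -mpolyX0 PsiX psi_std // mnm0E.
  by rewrite Psi_g1 // Psi_g2 // Psi1 !mulr1.
rewrite -[RHS](linear0 (Psi m g1 g2)) => /(Psi_inj m_gt0 hg1 hg2 surj) h0.
have e1 : (mnm3 m 0 0 == mnm3 0 m 0) = false.
  by apply/eqP => /mnmP/(_ v0); rewrite !mnm3E => e; move: m_gt0; rewrite e.
split.
  move/mpolyP/(_ (mnm3 m 0 0)): h0; rewrite mcoeff0 mcoeffD !mcoeffZ !mcoeffX eqxx.
  by rewrite eq_sym e1 mulr1 mulr0 addr0.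
move/mpolyP/(_ (mnm3 0 m 0)): h0; rewrite mcoeff0 mcoeffD !mcoeffZ !mcoeffX eqxx.
by rewrite e1 mulr1 mulr0 add0r.
Qed.

End Veronese.

(** * Genericity *)

(** Placing the corner of the grid at a point (x : y : z), the value of f at each vertex is f after
    an invertible linear change of variables, a nonzero polynomial. The product of these with z has
    a nonroot, which is then scaled to z = 1. *)
Lemma exists_grid (K : numFieldType) (m d : nat) (f : {mpoly K[3]}) :
  f != 0 -> f \is d.-homog ->
  exists al be : K, forall i : 'I_#|{: 'I_m * 'I_m}|, f.@[grid_pt al be i] != 0.
Proof.
move=> fn0 hf.
pose s (i : 'I_#|{: 'I_m * 'I_m}|) : 3.-tuple {mpoly K[3]} :=
  [tuple nth 0 [:: 'X_v0 + (bexp i).1%:R *: 'X_v2; 'X_v1 + (bexp i).2%:R *: 'X_v2; 'X_v2] j | j < 3].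
have sE i w : (f \mPo s i).@[w] = f.@[fun j => nth 0
    [:: w v0 + (bexp i).1%:R * w v2; w v1 + (bexp i).2%:R * w v2; w v2] j].
  rewrite comp_mpoly_meval; apply: meval_eq; elim/ord3P; rewrite tnth_mktuple /=.
  - by rewrite mevalD mevalZ !mevalXU.
  - by rewrite mevalD mevalZ !mevalXU.
  - by rewrite mevalXU.
have sn0 i : f \mPo s i != 0.
  have [v fv] := mpoly_nonroot fn0; apply: contraNneq fv => s0.
  pose w j := nth 0 [:: v v0 - (bexp i).1%:R * v v2; v v1 - (bexp i).2%:R * v v2; v v2] (j : 'I_3).
  have := sE i w; rewrite s0 meval0 => ->; apply/eqP/meval_eq.
  by elim/ord3P; rewrite /w /= ?subrK.
have X2 : ('X_v2 : {mpoly K[3]}) != 0 by rewrite -msupp_eq0 msuppX.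
have P0 : 'X_v2 * \prod_i (f \mPo s i) != 0 by rewrite mulf_neq0 //; apply/prodf_neq0.
have [w] := mpoly_nonroot P0.
rewrite mevalM mevalXU rmorph_prod mulf_eq0 negb_or => /andP[w2 /prodf_neq0 fw].
exists (w v0 / w v2), (w v1 / w v2) => i; have := fw i isT; rewrite /= sE.
apply: contraNneq => e0.
rewrite (meval_eq (v2 := fun j => w v2 * grid_pt (w v0 / w v2) (w v1 / w v2) i j)).
  by rewrite (meval_homog _ _ hf) e0 mulr0.
by elim/ord3P; rewrite /grid_pt /=; field.
Qed.

Section Genericity.
Variables (K : numClosedFieldType) (m N : nat) (mon : 'I_N.+1 -> 'X_{1..3}).
Hypotheses (m_gt0 : (0 < m)%N) (mon_deg : forall j, mdeg (mon j) = m).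
Hypotheses (mon_inj : injective mon) (mon_surj : forall a, mdeg a = m -> exists j, mon j = a).
Local Notation theta P := (P \mPo theta_tuple K mon).
Local Notation A := {mpoly K[N.+1 + N.+1]}.

Definition generic_form (s : 'I_N.+1 -> 'I_(N.+1 + N.+1)) : {mpoly A[3]} :=
  \sum_j ('X_(s j) : A) *: 'X_[mon j].

Lemma eval_generic_form s (u : 'I_(N.+1 + N.+1) -> K) :
  map_mpoly (meval u) (generic_form s) = theta (linear_form (u \o s)).
Proof.
rewrite theta_linear_form raddf_sum; apply: eq_bigr => j _ /=.
by rewrite map_mpolyZ map_mpolyX /= mevalXU.
Qed.

Definition generic_det (f : {mpoly K[3]}) : A :=
  general_det m_gt0 (generic_form (@lshift _ _)) (generic_form (@rshift _ _))
    (map_mpoly (@mpolyC _ K) f).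

Lemma eval_generic_det f u : (generic_det f).@[u] =
  general_det m_gt0 (theta (linear_form (u \o @lshift N.+1 N.+1)))
    (theta (linear_form (u \o @rshift N.+1 N.+1))) f.
Proof.
rewrite /generic_det map_general_det !eval_generic_form; congr general_det.
by apply/mpolyP => a; rewrite !mcoeff_map_mpoly /= mevalC.
Qed.

(** The witness is a grid avoiding C; by [theta_coef] its two forms are pullbacks of linear forms on
    P^N. *)
Lemma exists_general f : f != 0 -> f \is (m.*2 + 3).-homog -> exists u, (generic_det f).@[u] != 0.
Proof.
move=> f0 hf; have [al [be hgrid]] := exists_grid m f0 hf.
pose a j := (grid_form m v0 al)@_(mon j); pose b j := (grid_form m v1 be)@_(mon j).
pose u i := match fintype.split i with inl j => a j | inr j => b j end.
exists u; rewrite eval_generic_det.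
have -> : linear_form (u \o @lshift N.+1 N.+1) = linear_form a.
  by apply: eq_linear_form => j; rewrite /u /= (unsplitK (inl j)).
have -> : linear_form (u \o @rshift N.+1 N.+1) = linear_form b.
  by apply: eq_linear_form => j; rewrite /u /= (unsplitK (inr j)).
rewrite !(theta_coef mon_deg mon_inj mon_surj) ?grid_form_homog //.
exact: grid_general_det.
Qed.

End Genericity.

Lemma general_det_surj (K : fieldType) (m : nat) (m_gt0 : (0 < m)%N) (g1 g2 f : {mpoly K[3]}) :
  g1 \is m.-homog -> g2 \is m.-homog -> general_det m_gt0 g1 g2 f != 0 ->
  forall h, in_Psi m g1 g2 h.
Proof.
move=> hg1 hg2; rewrite /general_det !mulf_eq0 !negb_or -!andbA => /and4P[].
move=> /prodf_neq0 low _ _ _; apply: Psi_surj_of_low => // e le.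
by rewrite unitmxE unitfE; apply: (low (Ordinal le)).
Qed.

Theorem proposition11 (R : realType) (n : nat) (hn : (2 <= n)%N)
    (f : {mpoly R[i][3]}) (hf : smooth_plane_curve (2 * n + 1) f) :
  for_general_linear_forms2
    (fun eta1 eta2 : {mpoly R[i][(veronese_dim n).+1]} =>
      (exists L, section_coordinates eta1 eta2 L) /\
      forall L, section_coordinates eta1 eta2 L ->
        let J := section_ideal_in (veronese_curve n f) eta1 eta2 L in
        (exists F, macaulay_polynomial J F) /\
        forall F, macaulay_polynomial J F ->
          F \is 4.-homog /\
          exists r : nat, waring_number 4 F r /\ (r <= (n - 1) ^ 2)%N).
Proof.
pose m := n.-1; have m_gt0 : (0 < m)%N by rewrite /m; lia.
have sz : size (ternary_monomials m) = (veronese_dim n).+1.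
  by apply: size_ternary_monomials; lia.
pose mon (j : 'I_(veronese_dim n).+1) : 'X_{1..3} := nth 0%MM (ternary_monomials m) j.
have mon_deg j : mdeg (mon j) = m.
  by apply/eqP; rewrite -mem_ternary_monomials mem_nth // sz.
have mon_inj : injective mon.
  move=> i j /eqP; rewrite nth_uniq ?ternary_monomials_uniq ?sz //.
  by move/eqP/val_inj.
have mon_surj a : mdeg a = m -> exists j, mon j = a.
  move/eqP; rewrite -mem_ternary_monomials => ain; move: (ain); rewrite -index_mem sz => lt.
  by exists (Ordinal lt); rewrite /mon nth_index.
(* x^m and y^m are two distinct monomials of degree m. *)
have N_gt0 : (0 < veronese_dim n)%N.
  have [j1 e1] := mon_surj (mnm3 m 0 0) ltac:(by rewrite mdeg_mnm3 !addn0).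
  have [j2 e2] := mon_surj (mnm3 0 m 0) ltac:(by rewrite mdeg_mnm3 addn0).
  rewrite lt0n; apply/eqP => e0; have e12 : j1 = j2.
    by apply: ord_inj; have := ltn_ord j1; have := ltn_ord j2; lia.
  move: e1; rewrite e12 e2 => /mnmP/(_ v0); rewrite !mnm3E => e; by move: m_gt0; rewrite -e.
have hf' : smooth_plane_curve (m.*2 + 3) f.
  by rewrite (_ : (m.*2 + 3 = 2 * n + 1)%N) // /m -addnn; lia.
have f0 := smooth_curve_neq0 hf'.
pose p := generic_det mon m_gt0 f.
exists (fun u => p.@[u] != 0); split.
- exists (eq p) => u; split=> [pu|[_ <-] //]; by exists p.
- by apply: exists_general => //; case: hf'.
move=> u; rewrite eval_generic_det => gen.
have hg1 := theta_linear_form_homog mon_deg (u \o @lshift _ _).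
have hg2 := theta_linear_form_homog mon_deg (u \o @rshift _ _).
split.
  apply: (exists_section_coordinates m_gt0 mon_deg N_gt0).
  exact: general_det_surj hg1 hg2 gen.
move=> L LP J.
have XP w : veronese_curve n f w <-> exists (v : 'I_3 -> R[i]) (c : R[i]),
    [/\ nonzero_vec v, f.@[v] = 0, c != 0 &
    forall j, w j = c * ('X_[mon j] : {mpoly R[i][3]}).@[v]] by [].
rewrite subn1.
exact: (section_macaulay mon_deg mon_surj hf' XP (linear_form_homog _)
  (linear_form_homog _) LP gen).
Qed.
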